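(* Let $(a_0,b_0)$ be any pair of positive integers and let $(\mathbb{Y}_n)_{n\ge 0}$ be the Pólya walk starting at $\mathbb{Y}_0=(a_0,b_0)$. Then, for each integer $k\ge 1$, \[ \lim_{N\to\infty}\frac1N\sum_{n=1}^N I_k(\mathbb{Y}_n)=\frac{1}{k^2\,\zeta(2)}\quad\text{almost surely}. \]
   Context: $\mathbb{N}=\{1,2,3,\dots\}$ and $\zeta$ is the Riemann zeta function. The Pólya walk starting at $(a_0,b_0)\in\mathbb{N}^2$ is the discrete-time stochastic process $(\mathbb{Y}_n)_{n\ge0}$ in $\mathbb{N}^2$ with deterministic start $\mathbb{Y}_0=(a_0,b_0)$ such that, for each $n\ge 0$, given the history up to time $n$ with current position $\mathbb{Y}_n=(a_n,b_n)$, the jump $\mathbb{Y}_{n+1}-\mathbb{Y}_n$ equals $(1,0)$ with conditional probability $\frac{a_n}{a_n+b_n}$ and $(0,1)$ with conditional probability $\frac{b_n}{a_n+b_n}$. For an integer $k\ge1$, $I_k:\mathbb{N}^2\to\{0,1\}$ is the indicator of the set of $k$-visible points: $I_k(x,y)=1$ if $\gcd(x,y)=k$ and $I_k(x,y)=0$ otherwise. *)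

(* Defs.v *)
From HB Require Import structures.
From mathcomp Require Import all_boot all_order all_algebra.
From mathcomp Require Import all_classical all_reals all_analysis.

Set Implicit Arguments.
Unset Strict Implicit.
Unset Printing Implicit Defensive.

Import Order.TTheory GRing.Theory Num.Theory.
Import numFieldNormedType.Exports.

Local Open Scope classical_set_scope.
Local Open Scope ring_scope.

(* Sum of the Dirichlet series; only meaningful for 1 < s. *)
Definition zeta (R : realType) (s : R) : R :=
  limn (series (fun n : nat => n.+1%:R `^ (- s))).

(* P(A | B); only meaningful when P B != 0. *)
Definition cond_prob d (T : measurableType d) (R : realType)
    (P : probability T R) (A B : set T) : R :=
  fine (P (A `&` B)) / fine (P B).

Definition history d (T : measurableType d) (R : realType)
    (P : probability T R) (Y : nat -> {RV P >-> (nat * nat)%type})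
    (n : nat) (p : nat -> nat * nat) : set T :=
  [set w | forall i : nat, (i <= n)%N -> Y i w = p i].

(* The state space is {1, 2, ...}^2, hence [polya_pos].  As it is countable,
   conditioning on the past up to time n amounts to conditioning on each
   trajectory (p 0, ..., p n) of positive probability. *)
Record polya_walk d (T : measurableType d) (R : realType)
    (P : probability T R) (Y : nat -> {RV P >-> (nat * nat)%type})
    (a0 b0 : nat) : Prop := PolyaWalk {
  polya_pos : forall n w, (0 < (Y n w).1)%N /\ (0 < (Y n w).2)%N;
  polya_start : forall w, Y 0%N w = (a0, b0);
  polya_right : forall n (p : nat -> nat * nat),
    P (history Y n p) != 0%E ->
    cond_prob P [set w | Y n.+1 w = ((Y n w).1.+1, (Y n w).2)]
                (history Y n p)
    = (p n).1%:R / ((p n).1 + (p n).2)%:R;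
  polya_up : forall n (p : nat -> nat * nat),
    P (history Y n p) != 0%E ->
    cond_prob P [set w | Y n.+1 w = ((Y n w).1, (Y n w).2.+1)]
                (history Y n p)
    = (p n).2%:R / ((p n).1 + (p n).2)%:R
}.

Definition visible (k : nat) : set (nat * nat) :=
  [set z | gcdn z.1 z.2 = k].

(* Main.v *)
Require Import Defs.
From HB Require Import structures.
From mathcomp Require Import all_boot all_order all_algebra.
From mathcomp Require Import all_classical all_reals all_analysis.
From mathcomp Require Import ring lra zify.
From mathcomp Require polyrcf.

Set Implicit Arguments.
Unset Strict Implicit.
Unset Printing Implicit Defensive.

Import Order.TTheory GRing.Theory Num.Theory.
Import numFieldNormedType.Exports.

Local Open Scope classical_set_scope.
Local Open Scope ring_scope.

(** Write [s_n = a0 + b0 + n] for the sum of the coordinates of the walk at time [n]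
    and [X_n] for its first coordinate.  As [s_n] is deterministic and
    [gcd (X_n, s_n - X_n) = gcd (X_n, s_n)], everything is about the divisors that
    the random number [X_n] shares with the known number [s_n].

    Mixture of coin tossing.  A given finite trajectory has a probability that only
    depends on its end point, namely a ratio of Beta integrals
    [B(x, y) / B(a0, b0)] with [B(x, y)] the integral of [t^(x-1) (1-t)^(y-1)] over the
    unit interval ([prob_follows]).  So the law of the walk is an average over the bias
    [t] of laws of independent coin tosses, with a density in [t] bounded by
    [1 / B(a0, b0)]; hence every nonnegative function of the path has an expectation at
    most [1 / B(a0, b0)] times its expectation for a bias chosen uniformly
    ([markov_cylinder]).  Only polynomials in [t] are integrated, so the integral is
    defined algebraically on coefficients.

    Equidistribution modulo [m].  For a fixed bias, [X_n] modulo [m] is a lazy walk on a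
    cycle.  Its transition operator contracts the functions of mean zero by a factor
    controlled by [t (1 - t) / m^2] (a Poincare inequality on the cycle,
    [lazy_shift_contraction]), so the sum over [n <= N] of [1(m | s_n) (1(m | X_n) - 1/m)]
    has second moment [O(N m^2 / (t (1 - t)))] ([path_mean_sqr_visit_excess]).  The
    singularity of [1 / (t (1 - t))] costs only a factor [sqrt N] once [t] is averaged
    ([integral_sqr_visit_excess]).

    Large divisors.  Under a uniform bias [X_n - a0] is uniform on [0 .. n], so the mean
    proportion of times with [gcd (X_n, s_n) > M] is [O(1 / M)] ([integral_large_gcd]).

    Along the times [N = J^24], with [M = J^2], Markov's inequality bounds all
    the exceptional events for [m <= M] by [O(1 / J^2)], and Borel-Cantelli yields
    almost surely, as [J] grows, density [1 / m^2] for each event [m | gcd] and a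
    density of [gcd > z] at most about [1 / z] ([typical_eps], [cvg_frequency_dvdn],
    [frequency_tail]).

    The end is deterministic.  Sieving the multiples of [k] by the primes up to [z] gives
    density [k^-2 * prod (1 - p^-2)] to the set where [gcd / k] is free of these primes,
    which differs from [gcd = k] by a subset of [gcd > z].  The same sieve applied to the
    series of [zeta 2] shows that the product tends to [1 / zeta 2]
    ([euler_factor_dist]).  Since consecutive values of [J^24] have ratio tending to 1,
    the convergence extends to all times ([cvg_frequency_sample_size]). *)

(** * Integration of polynomials over the unit interval *)

Section UnitIntegral.
Context {R : realType}.
Implicit Types (p q : {poly R}).

(** The integral of [p] over the unit interval.  The definition through coefficients makes
    linearity and the fundamental theorem of calculus purely algebraic. *)
Definition unit_integral (p : {poly R}) : R :=
  \sum_(i < size p) p`_i / i.+1%:R.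
Local Notation L := unit_integral.

Lemma unit_integralE n p : (size p <= n)%N -> L p = \sum_(i < n) p`_i / i.+1%:R.
Proof.
move=> le_pn; rewrite /L (big_ord_widen n (fun i => p`_i / i.+1%:R)) //.
rewrite [RHS](bigID (fun i : 'I_n => (i < size p)%N)) /= [X in _ = _ + X]big1 ?addr0 //.
by move=> i; rewrite -leqNgt => /(nth_default 0) ->; rewrite mul0r.
Qed.

Lemma unit_integral_is_linear : linear L.
Proof.
move=> a p q; pose n := maxn (size p) (size q).
have lp : (size p <= n)%N by rewrite leq_maxl.
have lq : (size q <= n)%N by rewrite leq_maxr.
have lpq : (size (a *: p + q)%R <= n)%N.
  rewrite (leq_trans (size_polyD _ _)) // geq_max lq andbT.
  exact: leq_trans (size_scale_leq _ _) lp.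
rewrite (unit_integralE lp) (unit_integralE lq) (unit_integralE lpq).
rewrite scaler_sumr -big_split /=; apply: eq_bigr => i _.
by rewrite coefD coefZ mulrDl -mulrA.
Qed.
HB.instance Definition _ :=
  GRing.isLinear.Build R {poly R} R *:%R unit_integral unit_integral_is_linear.

Lemma unit_integralZ a p : L (a *: p) = a * L p.
Proof. exact: linearZ. Qed.

Lemma unit_integral_deriv p : L p^`() = p.[1] - p.[0].
Proof.
rewrite (@unit_integralE (size p).-1); last exact: size_poly.
rewrite horner_coef0; case: (posnP (size p)) => [/eqP | lt0p].
  by rewrite size_poly_eq0 => /eqP ->; rewrite size_poly0 big_ord0 horner0 coef0 subrr.
rewrite horner_coef -(prednK lt0p) big_ord_recl /= expr1n mulr1 addrC addKr.
apply: eq_bigr => i _; rewrite coef_deriv expr1n mulr1 -(mulr_natr p`_i.+1) mulfK //.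
Qed.

(** The one analytic fact about this functional: the antiderivative of a polynomial that is
    nonnegative on the unit interval is monotone there. *)
Lemma unit_integral_ge0 p : (forall a, 0 <= a <= 1 -> 0 <= p.[a]) -> 0 <= L p.
Proof.
move=> p_ge0; pose q := \poly_(i < (size p).+1) (p`_i.-1 / i%:R).
have dq : q^`() = p.
  apply/polyP => i; rewrite coef_deriv coef_poly ltnS /=.
  case: ltnP => [_|/(nth_default 0) ->]; last by rewrite mul0rn.
  by rewrite -(mulr_natr (_ / _)) divfK // pnatr_eq0.
rewrite -dq unit_integral_deriv subr_ge0.
apply: (@polyrcf.ler_hornerW _ 0 1 q) => [x|||]; rewrite ?in_itv /= ?lexx ?ler01 //.
by move=> /andP[/ltW x0 /ltW x1]; rewrite dq p_ge0 // x0.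
Qed.

Lemma le_unit_integral p q :
  (forall a, 0 <= a <= 1 -> p.[a] <= q.[a]) -> L p <= L q.
Proof.
move=> le_pq; rewrite -subr_ge0 -raddfB; apply: unit_integral_ge0 => a a01.
by rewrite hornerD hornerN subr_ge0 le_pq.
Qed.

(** Euler's Beta integral [B(i+1, j+1)]. *)
Definition beta_int (i j : nat) : R := L ('X^i * (1 - 'X) ^+ j).

Lemma beta_int_split i j : beta_int i j = beta_int i.+1 j + beta_int i j.+1.
Proof.
rewrite /beta_int -raddfD; congr L; rewrite !exprS; ring.
Qed.

(** Integration by parts. *)
Lemma beta_int_exchange i j :
  i.+1%:R * beta_int i j.+1 = j.+1%:R * beta_int i.+1 j.
Proof.
apply/eqP; rewrite -subr_eq0 /beta_int.
pose p : {poly R} := 'X^(i.+1) * (1 - 'X) ^+ j.+1.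
have -> : i.+1%:R * L ('X^i * (1 - 'X) ^+ j.+1 : {poly R})
          - j.+1%:R * L ('X^(i.+1) * (1 - 'X) ^+ j : {poly R}) = L p^`().
  rewrite -!unit_integralZ -raddfB /=; congr L.
  rewrite /p derivM derivXn deriv_exp derivB derivX derivC /= sub0r.
  by rewrite !scaler_nat mulrnAl mulN1r mulrnAr mulrN mulNrn.
by rewrite unit_integral_deriv /p !hornerE /= subrr !expr0n /= !(mulr0, mul0r) subrr.
Qed.

(** The ratio is the probability that the urn with [i+1] and [j+1] balls moves right: this
    identity and its mirror image are what makes the walk a mixture of coin tosses. *)
Lemma beta_int_succl i j :
  beta_int i.+1 j = i.+1%:R / (i + j).+2%:R * beta_int i j.
Proof.
have h := beta_int_exchange i j; rewrite (beta_int_split i j).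
have nz : (i + j).+2%:R != 0 :> R by rewrite pnatr_eq0.
have e2 : (i + j).+2%:R = i.+1%:R + j.+1%:R :> R by rewrite -natrD addSn addnS.
apply: (mulfI nz); rewrite [RHS]mulrA mulrCA divff // mulr1 mulrDr h e2 mulrDl.
by [].
Qed.

Lemma beta_int_succr i j :
  beta_int i j.+1 = j.+1%:R / (i + j).+2%:R * beta_int i j.
Proof.
have nz : (i + j).+2%:R != 0 :> R by rewrite pnatr_eq0.
have -> : beta_int i j.+1 = beta_int i j - beta_int i.+1 j.
  by rewrite [in RHS]beta_int_split addrC addKr.
rewrite beta_int_succl -[X in X - _]mul1r -mulrBl; congr (_ * _).
apply: (mulfI nz); rewrite mulrBr mulr1 !(mulrC (_.+2%:R)) !divfK //.
by rewrite -addnS -addSn natrD addrC addKr.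
Qed.

Lemma beta_int_n0 n : beta_int n 0 = n.+1%:R^-1.
Proof.
have nz : n.+1%:R != 0 :> R by rewrite pnatr_eq0.
rewrite /beta_int expr0 mulr1; apply: (mulfI nz); rewrite divff //.
have -> : n.+1%:R * L ('X^n : {poly R}) = L ('X^(n.+1) : {poly R})^`().
  by rewrite derivXn /= raddfMn /= mulr_natl.
by rewrite unit_integral_deriv !hornerE /= expr1n expr0n subr0.
Qed.

Lemma beta_int_gt0 i j : 0 < beta_int i j.
Proof.
elim: j i => [|j IH] i; first by rewrite beta_int_n0 invr_gt0 ltr0n.
by rewrite beta_int_succr !mulr_gt0 ?invr_gt0 ?ltr0n.
Qed.

(** The number of heads among [n] tosses of a coin of uniform bias is uniform on [0 .. n]. *)
Lemma bin_beta_int n i : (i <= n)%N -> 'C(n, i)%:R * beta_int i (n - i) = n.+1%:R^-1.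
Proof.
move=> le_in; rewrite -{1 2}(subKn le_in); move: (n - i)%N (leq_subr i n) => {i le_in} j.
elim: j => [|j IH] lt_jn; first by rewrite subn0 binn mul1r beta_int_n0.
have -> : (n.+1%:R^-1 = 'C(n, (n - j.+1).+1)%:R * beta_int (n - j.+1).+1 j).
  by rewrite -(IH (ltnW lt_jn)) -subSn // subSS.
set i := (n - j.+1)%N.
have nz : i.+1%:R != 0 :> R by rewrite pnatr_eq0.
apply: (mulfI nz); rewrite mulrCA beta_int_exchange mulrA mulrA -!natrM.
congr (_%:R * _); have := mul_bin_left n i.
by rewrite /i subKn // => ->; rewrite mulnC.
Qed.

(** The integrand is [(1 - 2 X)^(2 K)], which is close to 1 only near the two ends of the
    interval: its integral bounds the mass of the biases close to 0 or 1. *)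
Lemma unit_integral_sqr_centered K :
  L ((1 - 4%:R *: ('X * (1 - 'X))) ^+ K) = (2 * K).+1%:R^-1.
Proof.
have nz : (2 * K).+1%:R != 0 :> R by rewrite pnatr_eq0.
have -> : 1 - 4%:R *: ('X * (1 - 'X)) = (2%:R *: 'X - 1) ^+ 2 :> {poly R}.
  by rewrite -!mul_polyC !rmorph_nat; ring.
rewrite -exprM; apply: (mulfI nz); rewrite divff //.
have -> : (2 * K).+1%:R * L ((2%:R *: 'X - 1) ^+ (2 * K))
   = L (2%:R^-1 *: ((2%:R *: 'X - 1) ^+ (2 * K).+1)^`()).
  rewrite deriv_exp derivB derivZ derivX derivC subr0 /= alg_polyC.
  by rewrite mul_polyC unit_integralZ raddfMn /= unit_integralZ mulr_natl -mulrnAr mulKf // pnatr_eq0.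
rewrite unit_integralZ unit_integral_deriv !hornerE /=.
have -> : (2 - 1 = 1 :> R) by ring.
rewrite expr1n exprS exprM sqrrN !expr1n mulr1 opprK mulVf // pnatr_eq0 //.
Qed.

End UnitIntegral.

(** * Averages over coin-tossing paths *)

Section BernoulliPaths.
Context {R : realType}.
Implicit Types (F G : seq bool -> R) (a : R).

(** The mean of [F] over the paths of [N] independent tosses showing [true] with
    probability [a]. *)
Fixpoint path_mean (a : R) (N : nat) (F : seq bool -> R) : R :=
  if N is N'.+1 then
    a * path_mean a N' (fun e => F (true :: e))
    + (1 - a) * path_mean a N' (fun e => F (false :: e))
  else F [::].

(** The same mean, as a polynomial in the bias. *)
Fixpoint path_poly (N : nat) (F : seq bool -> R) : {poly R} :=
  if N is N'.+1 then
    'X * path_poly N' (fun e => F (true :: e))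
    + (1 - 'X) * path_poly N' (fun e => F (false :: e))
  else (F [::])%:P.

Lemma horner_path_poly N F a : (path_poly N F).[a] = path_mean a N F.
Proof.
by elim: N F => [|N IH] F /=; rewrite ?hornerC // !hornerE !IH.
Qed.

Lemma le_path_mean a N F G : 0 <= a <= 1 ->
  (forall e, size e = N -> F e <= G e) -> path_mean a N F <= path_mean a N G.
Proof.
move=> a01; elim: N F G => [|N IH] F G leFG /=; first exact: leFG.
have /andP[a0 a1] := a01.
by rewrite lerD // ler_wpM2l ?subr_ge0 // IH // => e se; rewrite leFG //= se.
Qed.

Lemma eq_path_mean a N F G :
  (forall e, F e = G e) -> path_mean a N F = path_mean a N G.
Proof. by move=> eqFG; congr path_mean; apply/funext. Qed.

Lemma path_mean_cst a N c : path_mean a N (fun=> c) = c.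
Proof. by elim: N => //= N ->; rewrite -mulrDl addrC subrK mul1r. Qed.

Lemma path_meanD a N F G :
  path_mean a N (fun e => F e + G e) = path_mean a N F + path_mean a N G.
Proof. by elim: N F G => //= N IH F G; rewrite !IH; ring. Qed.

Lemma path_meanZ a N c F :
  path_mean a N (fun e => c * F e) = c * path_mean a N F.
Proof. by elim: N F => //= N IH F; rewrite !IH; ring. Qed.

(** Sum of [h (X_n, s_n)] over the steps [n >= 1] of the path [e] that starts with
    [X_0 = x] and [s_0 = s]; the second coordinate of the walk is [s_n - X_n]. *)
Fixpoint path_sum (h : nat -> nat -> R) (x s : nat) (e : seq bool) : R :=
  if e is b :: e' then h (x + b)%N s.+1 + path_sum h (x + b) s.+1 e' else 0.

Lemma path_mean_sum a N h x s :
  path_mean a N (path_sum h x s) =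
  \sum_(i < N) path_mean a i.+1 (fun e => h (x + count id e)%N (s + i).+1).
Proof.
elim: N x s => [|N IH] x s /=; first by rewrite big_ord0.
rewrite !path_meanD !path_mean_cst !IH big_ord_recl /= !addn0 !mulrDr addrACA.
congr (_ + _); rewrite !mulr_sumr -big_split /=; apply: eq_bigr => i _.
rewrite /bump /= add1n !addSnnS.
congr (_ * (_ * _ + _ * _) + _ * (_ * _ + _ * _));
  by apply: eq_path_mean => e; congr (h _ _); lia.
Qed.

Lemma path_mean_count a n (f : nat -> R) :
  path_mean a n (fun e => f (count id e)) =
  \sum_(i < n.+1) 'C(n, i)%:R * f i * (a ^+ i * (1 - a) ^+ (n - i)).
Proof.
elim: n f => [|n IH] f /=.
  by rewrite big_ord1 /= bin0 !expr0 !mulr1 mul1r.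
rewrite (IH (fun i => f i.+1)) (IH f).
rewrite [in RHS]big_ord_recl /= bin0 expr0 !mul1r subn0.
under [in RHS]eq_bigr => i _ do
  rewrite /bump /= add1n binS natrD !mulrDl subSS exprS -!mulrA.
rewrite big_split /= [X in _ = _ + X]addrC addrCA; congr (_ + _).
  by rewrite mulr_sumr; apply: eq_bigr => i _; ring.
pose t i := 'C(n, i)%:R * f i * (a ^+ i * (1 - a) ^+ (n.+1 - i)).
transitivity (\sum_(i < n.+2) t i).
  rewrite [RHS]big_ord_recr /= /t bin_small // !mul0r addr0 mulr_sumr.
  apply: eq_bigr => i _; rewrite subSn ?exprS; last by rewrite -ltnS.
  by ring.
rewrite big_ord_recl /t /= bin0 expr0 !mul1r subn0; congr (_ + _).
apply: eq_bigr => i _; rewrite /bump /= add1n subSS exprS; ring.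
Qed.

(** * Contraction of a lazy walk on a cycle *)

Section CyclicFunctions.
Variable m : nat.
Hypothesis m_gt0 : (0 < m)%N.
Implicit Types (u v : nat -> R).

Definition periodic (u : nat -> R) := forall x, u (x + m)%N = u x.

Lemma periodic_sum_shift u y : periodic u ->
  \sum_(r < m) u (y + r)%N = \sum_(r < m) u r.
Proof.
move=> pu; elim: y => [|y <-]; first by apply: eq_bigr.
move: pu; rewrite /periodic; case: m m_gt0 => // k _ pu.
rewrite big_ord_recr [RHS]big_ord_recl /= addn0 addSnnS pu addrC.
by congr (_ + _); apply: eq_bigr => i _; rewrite /bump /= add1n addSnnS.
Qed.

(** Cauchy-Schwarz for a telescoping sum of [n] increments. *)
Lemma sqr_telescope_le u x n :
  (u (x + n)%N - u x) ^+ 2 <= n%:R * \sum_(i < n) (u (x + i)%N.+1 - u (x + i)%N) ^+ 2.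
Proof.
elim: n => [|n IH]; first by rewrite addn0 subrr expr0n mul0r.
rewrite big_ord_recr /= addnS.
set S := \sum_(i < n) _ in IH *; set A := u (x + n)%N - u x in IH *.
set d := u (x + n)%N.+1 - u (x + n)%N.
have -> : u (x + n)%N.+1 - u x = A + d by rewrite /A /d; ring.
case: n @A @S @d IH => [|n] A S d IH.
  by rewrite /S /A big_ord0 add0r addn0 subrr add0r mul1r.
have key : 0 <= n.+1%:R * (S - 2 * A * d + n.+1%:R * d ^+ 2).
  apply: le_trans (sqr_ge0 (A - n.+1%:R * d)) _.
  rewrite -subr_ge0; move: IH; rewrite -subr_ge0; congr (0 <= _); ring.
move: key; rewrite pmulr_rge0 ?ltr0n // => key.
rewrite -[n.+2]add1n natrD -subr_ge0.
have -> : (1 + n.+1%:R) * (S + d ^+ 2) - (A + d) ^+ 2 =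
  (n.+1%:R * S - A ^+ 2) + (S - 2 * A * d + n.+1%:R * d ^+ 2) by ring.
by rewrite addr_ge0 // subr_ge0.
Qed.

(** Two values of [u] on the cycle are joined by at most [m] steps, so the square of their
    difference is at most [m] times the energy; each value of a function of mean zero is an
    average of such differences. *)
Lemma cyclic_poincare u : periodic u -> \sum_(r < m) u r = 0 ->
  \sum_(r < m) u r ^+ 2 <= m%:R ^+ 2 * \sum_(r < m) (u r.+1 - u r) ^+ 2.
Proof.
move=> pu u0; set D := \sum_(r < m) (u _.+1 - _) ^+ 2.
have mR0 : 0 < m%:R :> R by rewrite ltr0n.
have D_ge0 : 0 <= D by apply: sumr_ge0 => i _; exact: sqr_ge0.
have step x n : (n <= m)%N -> (u (x + n)%N - u x) ^+ 2 <= m%:R * D.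
  move=> le_nm; apply: le_trans (sqr_telescope_le u x n) _.
  apply: ler_pM; rewrite ?ler0n ?ler_nat //.
    by apply: sumr_ge0 => i _; exact: sqr_ge0.
  rewrite /D -(periodic_sum_shift (u := fun r => (u r.+1 - u r) ^+ 2) x); last first.
    by move=> r; rewrite -addSn !pu.
  rewrite (big_ord_widen m (fun i => (u (x + i)%N.+1 - u (x + i)%N) ^+ 2)) //.
  rewrite [leRHS](bigID (fun i : 'I_m => (i < n)%N)) /= lerDl.
  by apply: sumr_ge0 => i _; exact: sqr_ge0.
have pt x : u x ^+ 2 <= m%:R * D.
  rewrite -(ler_pM2l mR0).
  have sum_le : \sum_(n < m) (u (x + n)%N - u x) ^+ 2 <= m%:R * (m%:R * D).
    rewrite [leRHS]mulr_natl -[X in _ *+ X]card_ord -sumr_const.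
    by apply: ler_sum => i _; apply: step; exact: ltnW.
  apply: le_trans sum_le.
  under eq_bigr => n _ do rewrite sqrrB.
  rewrite big_split sumrB /= sumr_const card_ord -(mulr_natl (u x ^+ 2)) lerDr subr_ge0.
  rewrite sumrMnl -mulr_suml (periodic_sum_shift x pu) u0 mul0r.
  by rewrite mul0rn; apply: sumr_ge0 => i _; exact: sqr_ge0.
rewrite expr2 -mulrA [leRHS]mulr_natl -[X in _ *+ X]card_ord -sumr_const.
exact: ler_sum.
Qed.

(** Transition operator of the walk on the cycle that advances with probability [a]. *)
Definition lazy_shift a (u : nat -> R) (x : nat) := a * u x.+1 + (1 - a) * u x.

Lemma lazy_shift_periodic a u : periodic u -> periodic (lazy_shift a u).
Proof. by move=> pu x; rewrite /lazy_shift -addSn !pu. Qed.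

Lemma sum_lazy_shift a u : periodic u ->
  \sum_(r < m) lazy_shift a u r = \sum_(r < m) u r.
Proof.
move=> pu; rewrite big_split /= -!mulr_sumr.
have -> : \sum_(r < m) u r.+1 = \sum_(r < m) u r := periodic_sum_shift 1 pu.
by rewrite -mulrDl addrC subrK mul1r.
Qed.

(** The parallelogram identity gives
    [(a u' + (1 - a) u)^2 = a u'^2 + (1 - a) u^2 - a (1 - a) (u' - u)^2];
    summed over the cycle, the last term is the energy, which the Poincare inequality bounds
    from below. *)
Lemma lazy_shift_contraction a u : 0 <= a <= 1 -> periodic u ->
    \sum_(r < m) u r = 0 ->
  m%:R ^+ 2 * \sum_(r < m) lazy_shift a u r ^+ 2 <=
  (m%:R ^+ 2 - a * (1 - a)) * \sum_(r < m) u r ^+ 2.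
Proof.
move=> /andP[a0 a1] pu u0.
have -> : \sum_(r < m) lazy_shift a u r ^+ 2 = \sum_(r < m) u r ^+ 2
    - a * (1 - a) * \sum_(r < m) (u r.+1 - u r) ^+ 2.
  have p2 : periodic (fun r => u r ^+ 2) by move=> x; rewrite pu.
  rewrite -{1}(sum_lazy_shift a p2) mulr_sumr -sumrB; apply: eq_bigr => r _.
  by rewrite /lazy_shift; ring.
have := ler_wpM2l (mulr_ge0 a0 (_ : 0 <= 1 - a)) (cyclic_poincare pu u0).
rewrite subr_ge0 => /(_ a1) key; rewrite mulrBl mulrBr lerD2l lerN2.
by rewrite (le_trans key) // mulrCA.
Qed.

(** At the times with [m %| s], the centred indicator of [m %| x]; its partial sums measure
    how far the visits to multiples of [m] are from equidistribution. *)
Definition visit_excess (m : nat) (x s : nat) : R :=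
  (m %| s)%N%:R * ((m %| x)%N%:R - m%:R^-1).

Lemma visit_excess_periodic s : periodic (visit_excess m ^~ s).
Proof. by move=> x; rewrite /visit_excess dvdn_addl. Qed.

Lemma dvdn_ord (r : 'I_m) : (m %| r)%N = (r == 0 :> nat).
Proof. by rewrite /dvdn modn_small. Qed.

Lemma sum_visit_excess s : \sum_(r < m) visit_excess m r s = 0.
Proof.
rewrite -mulr_sumr sumrB sumr_const card_ord.
under eq_bigr do rewrite dvdn_ord.
have -> : m%:R^-1 *+ m = 1 :> R by rewrite -[LHS]mulr_natl divff // pnatr_eq0 -lt0n.
case: m m_gt0 => // k _; rewrite big_ord_recl /= big1 ?addr0 ?subrr ?mulr0 //.
Qed.

Lemma sum_sqr_visit_excess s : \sum_(r < m) visit_excess m r s ^+ 2 <= 1.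
Proof.
have nz : m%:R != 0 :> R by rewrite pnatr_eq0 -lt0n.
(* Forget the factor [m %| s] and expand the square of the indicator minus [1 / m]. *)
have le1 (r : 'I_m) : visit_excess m r s ^+ 2
   <= ((r == 0 :> nat)%:R * (1 - 2 / m%:R) + m%:R^-1 ^+ 2).
  rewrite /visit_excess dvdn_ord exprMn.
  apply: (@le_trans _ _ (1 * ((r == 0 :> nat)%:R - m%:R^-1) ^+ 2)).
    by rewrite ler_wpM2r ?sqr_ge0 //; case: (m %| s)%N; rewrite /= ?expr1n ?expr0n.
  by rewrite le_eqVlt; apply/orP; left; apply/eqP; case: (_ == _) => /=; ring.
apply: le_trans (ler_sum _ (fun i _ => le1 i)) _.
rewrite big_split /= sumr_const card_ord -mulr_suml.
have -> : \sum_(i < m) (i == 0 :> nat)%:R = 1 :> R.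
  by case: m m_gt0 => // k _; rewrite big_ord_recl /= big1 ?addr0.
rewrite -(mulr_natl (m%:R^-1 ^+ 2)) mul1r expr2 mulVKf //.
have : 0 <= m%:R^-1 :> R by rewrite invr_ge0.
lra.
Qed.

(** The expected excess over [N] steps, as a function of the starting point, obeys
    [A_(N+1) = lazy_shift (g + A_N)] with [g] of norm at most 1.  The contraction makes the
    norms bounded uniformly in [N]: the bound [K] is stable because
    [(1 - c) (1 + K)^2 <= K^2] when [c K = 2], where [c = a (1 - a) / m^2]. *)
Lemma path_mean_visit_excess a N s (u := fun x => path_mean a N (path_sum (visit_excess m) x s)) :
  0 <= a <= 1 -> 0 < a * (1 - a) ->
  [/\ periodic u, \sum_(r < m) u r = 0 &
      \sum_(r < m) u r ^+ 2 <= (2 * m%:R ^+ 2 / (a * (1 - a))) ^+ 2].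
Proof.
move=> a01 ab0; set K := 2 * _ / _.
have m2_gt0 : 0 < m%:R ^+ 2 :> R by rewrite exprn_gt0 // ltr0n.
have K_gt0 : 0 < K by rewrite /K divr_gt0 // mulr_gt0.
rewrite {}/u; elim: N s => [|N IH] s.
  split=> //; first by rewrite big1.
  by rewrite big1 ?sqr_ge0 // => i _; rewrite expr0n.
have [pA A0 A2] := IH s.+1.
set A := fun x => path_mean a N _ in pA A0 A2.
pose g := visit_excess m ^~ s.+1.
pose v x := g x + A x.
have pv : periodic v by move=> x; rewrite /v /g visit_excess_periodic pA.
have v0 : \sum_(r < m) v r = 0 by rewrite big_split /= sum_visit_excess A0 addr0.
have v2 : \sum_(r < m) v r ^+ 2 <= (1 + K) ^+ 2.
  (* [(x + y)^2 <= (1 + K) x^2 + (1 + 1/K) y^2]; this choice of weights is the one for which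
     the bounds 1 and [K] on the norms give [(1 + K)^2]. *)
  have le2 r : v r ^+ 2 <= (1 + K) * g r ^+ 2 + (1 + K^-1) * A r ^+ 2.
    rewrite -subr_ge0 /v.
    have -> : (1 + K) * g r ^+ 2 + (1 + K^-1) * A r ^+ 2 - (g r + A r) ^+ 2
       = K^-1 * (K * g r - A r) ^+ 2.
      by field; rewrite gt_eqF.
    by rewrite mulr_ge0 ?sqr_ge0 // invr_ge0 ltW.
  apply: (@le_trans _ _ (\sum_(r < m) ((1 + K) * g r ^+ 2 + (1 + K^-1) * A r ^+ 2))).
    by apply: ler_sum => r _; exact: le2.
  rewrite big_split /= -!mulr_sumr.
  have -> : (1 + K) ^+ 2 = (1 + K) * 1 + (1 + K^-1) * K ^+ 2.
    by field; rewrite gt_eqF.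
  rewrite lerD // ler_pM2l ?sum_sqr_visit_excess ?addr_gt0 ?invr_gt0 //.
have Te x : path_mean a N.+1 (path_sum (visit_excess m) x s) = lazy_shift a v x.
  by rewrite /= /lazy_shift /v /g /A !path_meanD !path_mean_cst addn1 addn0.
under eq_bigr do rewrite Te; under [in X in X <= _]eq_bigr do rewrite Te.
split; first by rewrite (funext Te); exact: lazy_shift_periodic.
  by rewrite sum_lazy_shift.
rewrite -(ler_pM2l m2_gt0).
apply: le_trans (lazy_shift_contraction a01 pv v0) _.
set M2 := m%:R ^+ 2 in m2_gt0 *; set ab := a * (1 - a) in ab0 *.
have ab_le : ab <= M2.
  have : 1 <= M2 by rewrite /M2 expr_ge1 // ?ler0n // ler1n.
  rewrite /ab; have := sqr_ge0 (a - 2^-1); move: a01 => /andP[]; nra.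
apply: le_trans (ler_wpM2l _ v2) _; first by rewrite subr_ge0.
have -> : ab = 2 * M2 / K by rewrite /K -/ab -/M2; field; rewrite !gt_eqF.
rewrite -subr_ge0.
have -> : M2 * K ^+ 2 - (M2 - 2 * M2 / K) * (1 + K) ^+ 2 = M2 * (3 + 2 / K).
  by field; rewrite gt_eqF.
by rewrite mulr_ge0 ?addr_ge0 ?mulr_ge0 ?invr_ge0 // ltW.
Qed.

Lemma visit_excess_norm x s : `|visit_excess m x s| <= 1.
Proof.
have : 0 <= (m%:R^-1 : R) <= 1 by rewrite invr_ge0 ler0n invf_le1 ?ler1n ?ltr0n.
rewrite /visit_excess ler_norml; case: (m %| s)%N; case: (m %| x)%N => /=; lra.
Qed.

Lemma path_sum_norm (h : nat -> nat -> R) x s e : (forall x s, `|h x s| <= 1) ->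
  `|path_sum h x s e| <= (size e)%:R.
Proof.
move=> h1; elim: e x s => [|b e IH] x s /=; first by rewrite normr0.
by rewrite (le_trans (ler_normD _ _)) // -[(size e).+1]add1n natrD lerD.
Qed.

(** Expanding the square after the first step, the cross term is [g] times the expected
    remaining excess, which is bounded uniformly in the number of steps; so the second moment
    grows linearly in [N]. *)
Lemma path_mean_sqr_visit_excess a N x s : 0 <= a <= 1 ->
  a * (1 - a) * path_mean a N (fun e => path_sum (visit_excess m) x s e ^+ 2)
  <= 5 * N%:R * m%:R ^+ 2.
Proof.
move=> a01; have /andP[a0 a1] := a01.
have rhs0 : 0 <= 5 * N%:R * m%:R ^+ 2 :> R by rewrite !mulr_ge0 ?sqr_ge0.
have [ab0|] := ltP 0 (a * (1 - a)); last first.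
  rewrite le_eqVlt ltNge mulr_ge0 ?subr_ge0 // orbF => /eqP ->.
  by rewrite mul0r.
set K := 2 * m%:R ^+ 2 / (a * (1 - a)).
have m1 : 1 <= m%:R ^+ 2 :> R by rewrite expr_ge1 // ?ler0n // ler1n.
have K0 : 0 <= K by rewrite !mulr_ge0 ?invr_ge0 ?sqr_ge0 // ltW.
have A_le n y t : `|path_mean a n (path_sum (visit_excess m) y t)| <= K.
  have [pA _ A2] := path_mean_visit_excess n t a01 ab0.
  rewrite -(ler_pXn2r (n := 2)) ?nnegrE ?normr_ge0 // real_normK ?num_real //.
  apply: le_trans A2.
  rewrite -(periodic_sum_shift (u := fun y => path_mean a n (path_sum (visit_excess m) y t) ^+ 2) y); last first.
    by move=> z; rewrite [path_mean _ _ _]pA.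
  rewrite (bigD1 (Ordinal m_gt0)) //= addn0 lerDl.
  by apply: sumr_ge0 => i _; exact: sqr_ge0.
have B_le n y t : path_mean a n (fun e => path_sum (visit_excess m) y t e ^+ 2)
    <= n%:R * (1 + 2 * K).
  elim: n y t => [|n IH] y t /=; first by rewrite expr0n mul0r.
  have one z : path_mean a n (fun e => (visit_excess m z t.+1
        + path_sum (visit_excess m) z t.+1 e) ^+ 2) <= n.+1%:R * (1 + 2 * K).
    set g := visit_excess m z t.+1.
    rewrite (_ : path_mean _ _ _ = g ^+ 2 + (2 * g * path_mean a n (path_sum (visit_excess m) z t.+1)
       + path_mean a n (fun e => path_sum (visit_excess m) z t.+1 e ^+ 2))); last first.
      rewrite -path_meanZ -path_meanD -[X in X + _](path_mean_cst a n) -path_meanD.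
      by apply: eq_path_mean => e; ring.
    have -> : n.+1%:R * (1 + 2 * K) = (1 + 2 * K) + n%:R * (1 + 2 * K).
      by rewrite -[n.+1]add1n natrD; ring.
    rewrite addrA; apply: lerD; last exact: IH.
    have g1 : `|g| <= 1 := visit_excess_norm z t.+1.
    have Az := A_le n z t.+1; clearbody g.
    apply: lerD; first by rewrite -real_normK ?num_real // exprn_ile1.
    rewrite (le_trans (ler_norm _)) // !normrM normr_nat -mulrA ler_pM2l //.
    by rewrite -[K]mul1r ler_pM.
  apply: (@le_trans _ _ (a * (n.+1%:R * (1 + 2 * K)) + (1 - a) * (n.+1%:R * (1 + 2 * K)))).
    by rewrite lerD // ler_wpM2l ?subr_ge0.
  by rewrite -mulrDl addrC subrK mul1r.
apply: le_trans (ler_wpM2l (ltW ab0) (B_le N x s)) _.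
have -> : a * (1 - a) * (N%:R * (1 + 2 * K)) = N%:R * (a * (1 - a) + 4 * m%:R ^+ 2).
  by rewrite /K; set c := a * (1 - a) in ab0 *; field; rewrite gt_eqF.
have -> : 5 * N%:R * m%:R ^+ 2 = N%:R * (5 * m%:R ^+ 2) :> R by ring.
rewrite ler_wpM2l //.
have := sqr_ge0 (a - 2^-1); nra.
Qed.

End CyclicFunctions.
End BernoulliPaths.

(** * Averaging over a uniform bias *)

Section MixedPaths.
Context {R : realType}.
Local Notation L := (@unit_integral R).

Lemma eq_unit_integral (p q : {poly R}) :
  (forall a, 0 <= a <= 1 -> p.[a] = q.[a]) -> L p = L q.
Proof.
move=> eq_pq; apply: le_anti; apply/andP; split;
  by apply: le_unit_integral => a a01; rewrite eq_pq.
Qed.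

Lemma bernoulli_sub (t : R) q : 0 <= t <= 1 -> 1 - q%:R * t <= (1 - t) ^+ q.
Proof.
move=> /andP[t0 t1]; elim: q => [|q IH]; first by rewrite mul0r subr0 expr0.
rewrite exprS; apply: (@le_trans _ _ ((1 - t) * (1 - q%:R * t))); last first.
  by rewrite ler_wpM2l // subr_ge0.
rewrite -[q.+1]add1n natrD -subr_ge0.
have -> : (1 - t) * (1 - q%:R * t) - (1 - (1%:R + q%:R) * t) = q%:R * t ^+ 2 by ring.
by rewrite mulr_ge0 // sqr_ge0.
Qed.

(** The pointwise bound has the form [t * F <= c] with [t = 4 a (1 - a)] and [0 <= F <= N^2].
    To integrate [F] despite the zeros of [t], split [F] as
    [F (1 - t)^q + F (1 - (1 - t)^q)]: the first part has integral at most [N^2 / (2 q + 1)],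
    and the second is at most [q t F <= q c] by Bernoulli's inequality.  The number of
    steps [N = q^2] balances the two. *)
Lemma integral_sqr_visit_excess m q x s : (0 < m)%N -> (0 < q)%N ->
  L (path_poly (q ^ 2) (fun e => path_sum (visit_excess m) x s e ^+ 2))
  <= 21 * m%:R ^+ 2 * q%:R ^+ 3.
Proof.
move=> m0 q0; pose N := (q ^ 2)%N; pose B : R := 4 * q%:R * (5 * N%:R * m%:R ^+ 2).
have q_gt0 : 0 < q%:R :> R by rewrite ltr0n.
have m_ge1 : 1 <= m%:R ^+ 2 :> R by rewrite expr_ge1 // ?ler0n // ler1n.
(* The majorant of the mean as a polynomial in the bias. *)
pose pb : {poly R} := N%:R ^+ 2 *: (1 - 4%:R *: ('X * (1 - 'X))) ^+ q + B%:P.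
apply: (@le_trans _ _ (L pb)).
  apply: le_unit_integral => a a01; rewrite horner_path_poly.
  have -> : pb.[a] = N%:R ^+ 2 * (1 - 4 * (a * (1 - a))) ^+ q + B.
    by rewrite /pb !hornerE.
  have F0 : 0 <= path_mean a N (fun e => path_sum (visit_excess m) x s e ^+ 2).
    rewrite -(path_mean_cst a N 0); apply: le_path_mean => // e _; exact: sqr_ge0.
  have F1 : path_mean a N (fun e => path_sum (visit_excess m) x s e ^+ 2) <= N%:R ^+ 2.
    rewrite -[leRHS](path_mean_cst a N); apply: le_path_mean => // e <-.
    rewrite -real_normK ?num_real // lerXn2r ?nnegrE ?normr_ge0 //.
    by apply: path_sum_norm => *; exact: visit_excess_norm.
  have := path_mean_sqr_visit_excess m0 N x s a01.
  move: F0 F1; set F := path_mean _ _ _ => F0 F1 F2.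
  pose t := 4 * (a * (1 - a)).
  have t01 : 0 <= t <= 1.
    rewrite /t; have := sqr_ge0 (a - 2^-1); move: a01 => /andP[? ?] ?.
    by apply/andP; split; nra.
  have h := bernoulli_sub q t01; rewrite -/t.
  have F3 : t * F <= 4 * (5 * N%:R * m%:R ^+ 2).
    by rewrite /t -(mulrA 4) ler_pM2l.
  apply: (@le_trans _ _ (F * (1 - t) ^+ q + F * (1 - (1 - t) ^+ q))).
    by rewrite -mulrDr addrC subrK mulr1.
  apply: lerD; first by rewrite ler_wpM2r // exprn_ge0 // subr_ge0; case/andP: t01.
  apply: (@le_trans _ _ (F * (q%:R * t))); first by rewrite ler_wpM2l // lerBlDl -lerBlDr.
  have -> : F * (q%:R * t) = q%:R * (t * F) by ring.
  have -> : B = q%:R * (4 * (5 * N%:R * m%:R ^+ 2)) by rewrite /B; ring.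
  by rewrite ler_wpM2l.
rewrite /pb raddfD /= unit_integralZ unit_integral_sqr_centered.
have -> : L B%:P = B.
  have := @beta_int_n0 R 0; rewrite /beta_int !expr0 mulr1 invr1 => L1.
  by rewrite -alg_polyC unit_integralZ L1 mulr1.
have NE : N%:R = q%:R ^+ 2 :> R by rewrite /N natrX.
have step : N%:R ^+ 2 / (2 * q).+1%:R <= q%:R ^+ 3 :> R.
  rewrite ler_pdivrMr ?ltr0n // NE -exprM -[leLHS]mulr1 (exprSr _ 3) -mulrA.
  rewrite mulr1 ler_wpM2l ?exprn_ge0 // ?ler0n // ler_nat; lia.
apply: le_trans (lerD step (lexx _)) _.
have -> : 21 * m%:R ^+ 2 * q%:R ^+ 3 = m%:R ^+ 2 * q%:R ^+ 3 + B :> R by rewrite /B NE; ring.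
by rewrite lerD2r ler_peMl // exprn_ge0 // ltW.
Qed.

(** Under a uniform bias the position after [i + 1] steps is uniform on [i + 2] values. *)
Lemma integral_path_sum N h x s :
  L (path_poly N (path_sum h x s)) =
  \sum_(i < N) i.+2%:R^-1 * \sum_(j < i.+2) h (x + j)%N (s + i).+1.
Proof.
transitivity (L (\sum_(i < N) \sum_(j < i.+2)
   ('C(i.+1, j)%:R * h (x + j)%N (s + i).+1) *: ('X^j * (1 - 'X) ^+ (i.+1 - j)))).
  apply: eq_unit_integral => a _; rewrite horner_path_poly path_mean_sum.
  rewrite horner_sum; apply: eq_bigr => i _.
  rewrite (path_mean_count a i.+1 (fun j => h (x + j)%N (s + i).+1)) horner_sum.
  by apply: eq_bigr => j _; rewrite !hornerE.
rewrite raddf_sum /=; apply: eq_bigr => i _.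
rewrite raddf_sum /= mulr_sumr; apply: eq_bigr => j _.
have le_ji : (j <= i.+1)%N by rewrite -ltnS.
rewrite unit_integralZ -(bin_beta_int le_ji) /beta_int.
by rewrite mulrAC.
Qed.

Lemma sum_dvdn n m : (0 < m)%N -> (\sum_(j < n) (m %| j.+1) = n %/ m)%N.
Proof.
move=> m0; elim: n => [|n IH]; first by rewrite big_ord0 div0n.
by rewrite big_ord_recr /= IH divnS // addnC.
Qed.

Lemma sum_dvdn_shift_le n m y : (0 < m)%N ->
  \sum_(j < n) (m %| y + j.+1)%N%:R <= (y + n)%:R / m%:R :> R.
Proof.
move=> m0; rewrite ler_pdivlMr ?ltr0n // -natr_sum -natrM ler_nat.
apply: leq_trans (leq_divM (y + n) m); rewrite leq_mul2r; apply/orP; right.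
rewrite -sum_dvdn // big_split_ord /= -[leqLHS]add0n leq_add //.
by apply: leq_sum => i _; rewrite addnS.
Qed.

Lemma sum_inv_sqr_le M B : (0 < M)%N ->
  \sum_(M.+1 <= m < B) (m%:R ^+ 2)^-1 <= M%:R^-1 :> R.
Proof.
move=> M0; have [le_BM|lt_MB] := leqP B M.
  by rewrite big_geq ?invr_ge0 // leqW.
have : \sum_(M.+1 <= m < B) (m%:R ^+ 2)^-1 <= M%:R^-1 - B.-1%:R^-1 :> R.
  elim: B lt_MB => // B IH; rewrite ltnS leq_eqVlt => /predU1P[<-|lt_MB].
    by rewrite big_geq //= subrr.
  rewrite big_nat_recr //=; apply: le_trans (lerD (IH lt_MB) (lexx _)) _.
  case: B lt_MB {IH} => // B; rewrite ltnS => le_MB /=.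
  have B0 : 0 < B%:R :> R by rewrite ltr0n; lia.
  rewrite -[B.+1]add1n natrD -subr_ge0.
  have -> : M%:R^-1 - (1%:R + B%:R)^-1 - (M%:R^-1 - B%:R^-1 + ((1%:R + B%:R) ^+ 2)^-1)
    = (B%:R * (1 + B%:R) ^+ 2)^-1 :> R.
    by field; rewrite gt_eqF //= gt_eqF ?addr_gt0 //= pnatr_eq0 -lt0n.
  by rewrite invr_ge0 mulr_ge0 ?sqr_ge0 // ltW.
by move/le_trans; apply; rewrite gerBl invr_ge0.
Qed.

(** An indicator, as a real number, so that it can be summed along a path. *)
Definition large_gcd (M x s : nat) : R := (M < gcdn x s)%N%:R.

(** If the gcd exceeds [M], then it is some [m > M] dividing both coordinates.  The condition on
    [s_n] holds for a proportion about [1 / m] of the times and, the position being uniform,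
    the condition on [X_n] has probability about [1 / m]; and the sum of [1 / m^2] over
    [m > M] is at most [1 / M]. *)
Lemma integral_large_gcd M N x s : (0 < M)%N -> (0 < N)%N -> (0 < x)%N ->
  L (path_poly N (path_sum (large_gcd M) x s))
  <= (x * s.+1)%:R * N%:R / M%:R.
Proof.
move=> M0 N0 x0; rewrite integral_path_sum.
pose B := (s + N).+1.
(* The witness is [m = gcd], which is below [B] because it divides [s_n]. *)
have dom i y : (i < N)%N -> large_gcd M y (s + i).+1 <=
    \sum_(M.+1 <= m < B) (m %| (s + i).+1)%N%:R * (m %| y)%N%:R.
  move=> lt_iN; rewrite /large_gcd; case: ltnP => [lt_Mg|_]; last by apply: sumr_ge0.
  have lt_gB : (gcdn y (s + i).+1 < B)%N.
    by rewrite ltnS (leq_trans (dvdn_leq _ (dvdn_gcdr _ _))) // /B; lia.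
  rewrite (bigD1_seq (gcdn y (s + i).+1)) ?iota_uniq ?mem_index_iota ?lt_Mg //=.
  by rewrite dvdn_gcdl dvdn_gcdr mulr1 lerDl sumr_ge0.
(* For each [m] the uniform position falls on a multiple of [m] with probability at most
   [x / m]: there are at most [(x + i + 1) / m] multiples among the [i + 2] values. *)
have inner (i : 'I_N) : i.+2%:R^-1 * \sum_(j < i.+2) large_gcd M (x + j) (s + i).+1
    <= \sum_(M.+1 <= m < B) (m %| (s + i).+1)%N%:R * (x%:R / m%:R).
  rewrite mulrC ler_pdivrMr ?ltr0n //.
  apply: (@le_trans _ _ (\sum_(j < i.+2) \sum_(M.+1 <= m < B)
      (m %| (s + i).+1)%N%:R * (m %| x + j)%N%:R)).
    by apply: ler_sum => j _; exact: dom.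
  rewrite exchange_big /= mulr_suml big_nat [leRHS]big_nat.
  apply: ler_sum => m /andP[lt_Mm _]; rewrite -mulr_sumr -mulrA ler_wpM2l //.
  have m0 : (0 < m)%N by rewrite (leq_trans _ lt_Mm).
  have h := sum_dvdn_shift_le i.+2 x.-1 m0.
  rewrite mulrAC ler_pdivlMr ?ltr0n //.
  apply: (@le_trans _ _ ((x.-1 + i.+2)%:R)); last by rewrite -natrM ler_nat; nia.
  move: h; rewrite ler_pdivlMr ?ltr0n //; congr (_ * _ <= _).
  by apply: eq_bigr => j _; rewrite addnS -addSn prednK.
apply: le_trans (ler_sum _ (fun i _ => inner i)) _.
rewrite exchange_big /=.
apply: (@le_trans _ _ (\sum_(M.+1 <= m < B) (x * (s + N))%:R * (m%:R ^+ 2)^-1)).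
  rewrite big_nat [leRHS]big_nat; apply: ler_sum => m /andP[lt_Mm _].
  have m0 : (0 < m)%N by rewrite (leq_trans _ lt_Mm).
  rewrite -mulr_suml mulrC expr2 invfM natrM mulrACA -mulrA.
  rewrite [leRHS](_ : _ = x%:R / m%:R * ((s + N)%:R / m%:R)); last by ring.
  rewrite [leLHS](_ : _ = x%:R / m%:R * \sum_(i < N) (m %| (s + i).+1)%N%:R); last by ring.
  rewrite ler_wpM2l ?divr_ge0 // (le_trans _ (sum_dvdn_shift_le N s m0)) //.
  by apply: ler_sum => i _; rewrite addnS.
rewrite -mulr_sumr.
apply: le_trans (ler_wpM2l _ (sum_inv_sqr_le B M0)) _; first by [].
rewrite ler_wpM2r ?invr_ge0 // -natrM ler_nat; nia.
Qed.

End MixedPaths.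

(** * The law of the walk as a mixture *)

Lemma path_polyD (R : realType) N (F G : seq bool -> R) :
  path_poly N (fun e => F e + G e) = path_poly N F + path_poly N G.
Proof.
elim: N F G => [|N IH] F G /=; first by rewrite polyCD.
by rewrite !IH !mulrDr addrACA.
Qed.

Lemma path_polyZ (R : realType) N c (F : seq bool -> R) :
  path_poly N (fun e => c * F e) = c *: path_poly N F.
Proof.
elim: N F => [|N IH] F /=; first by rewrite -mul_polyC polyCM.
by rewrite !IH scalerDr !scalerAr.
Qed.

Lemma path_poly_sum (R : realType) N (r : seq nat) (F : nat -> seq bool -> R) :
  path_poly N (fun e => \sum_(m <- r) F m e) = \sum_(m <- r) path_poly N (F m).
Proof.
elim: r => [|m r IH]; last first.
  rewrite big_cons -IH -path_polyD; congr path_poly.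
  by apply/funext => e; rewrite big_cons.
rewrite big_nil (_ : (fun e => _) = (fun e => 0 * 0)); last first.
  by apply/funext => e; rewrite big_nil mul0r.
by rewrite path_polyZ scale0r.
Qed.

(** Position reached by the path [e]; [true] stands for a step to the right. *)
Definition urn (a b : nat) (e : seq bool) : nat * nat :=
  (a + count id e, b + count negb e)%N.

Section WalkLaw.
Context d (T : measurableType d) (R : realType) (P : probability T R)
  (Y : nat -> {RV P >-> (nat * nat)%type}) (a0 b0 : nat).
Hypotheses (ha0 : (0 < a0)%N) (hb0 : (0 < b0)%N) (hY : polya_walk Y a0 b0).
Implicit Types (e : seq bool) (Q : seq bool -> bool).

(** The event that the walk follows the path [e]; in terms of [history], so that the
    transition probabilities apply to it. *)
Definition follows e : set T := history Y (size e) (fun i => urn a0 b0 (take i e)).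

Lemma followsE e w :
  follows e w <-> forall i, (i <= size e)%N -> Y i w = urn a0 b0 (take i e).
Proof. by []. Qed.

Lemma measurable_RV_set1 n z : measurable [set w | Y n w = z].
Proof.
have -> : [set w | Y n w = z] = Y n @^-1` ([set z.1] `*` [set z.2]).
  apply/seteqP; split => w /=; first by move=> ->.
  by case: (Y n w) z => [x y] [x' y'] /= [-> ->].
by apply: measurable_funPTI; exact: measurableX.
Qed.

Lemma measurable_follows e : measurable (follows e).
Proof.
rewrite /follows /history.
have -> : [set w | forall i, (i <= size e)%N -> Y i w = urn a0 b0 (take i e)]
    = \bigcap_(i in [set i | (i <= size e)%N]) [set w | Y i w = urn a0 b0 (take i e)].
  by apply/seteqP; split.
by apply: bigcap_measurableType => // i _; exact: measurable_RV_set1.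
Qed.

Lemma follows_rconsE e b : follows (rcons e b) =
  [set w | Y (size e).+1 w = urn a0 b0 (rcons e b)] `&` follows e.
Proof.
apply/seteqP; split => w; rewrite /setI /= !followsE size_rcons.
  move=> h; split=> [|i le_i]; first by rewrite h // take_oversize // size_rcons.
  by rewrite h ?leqW // -cats1 takel_cat.
move=> [hl h] i; rewrite leq_eqVlt => /predU1P[->|lt_i].
  by rewrite hl take_oversize // size_rcons.
by rewrite h // -cats1 takel_cat.
Qed.

Lemma urn_rcons e b : urn a0 b0 (rcons e b) =
  if b then ((urn a0 b0 e).1.+1, (urn a0 b0 e).2)
  else ((urn a0 b0 e).1, (urn a0 b0 e).2.+1).
Proof. by rewrite /urn -cats1 !count_cat; case: b => /=; rewrite ?addn0 ?addn1 ?addnS. Qed.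

Lemma follows_rcons_step e b : follows (rcons e b) =
  [set w | Y (size e).+1 w = if b then ((Y (size e) w).1.+1, (Y (size e) w).2)
           else ((Y (size e) w).1, (Y (size e) w).2.+1)] `&` follows e.
Proof.
rewrite follows_rconsE urn_rcons; apply/seteqP; split => w /= [h1 h2]; split=> //;
  by move: h1 (h2 _ (leqnn _)); rewrite take_size => -> ->.
Qed.

Lemma prob_follows_rcons e b : fine (P (follows (rcons e b))) =
  (if b then (urn a0 b0 e).1 else (urn a0 b0 e).2)%:R
  / ((urn a0 b0 e).1 + (urn a0 b0 e).2)%:R * fine (P (follows e)).
Proof.
have [P0|P0] := eqVneq (P (follows e)) 0%E.
  have : (P (follows (rcons e b)) <= P (follows e))%E.
    by apply: le_measure; rewrite ?inE ?follows_rconsE; [apply: measurableI|..];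
      rewrite ?follows_rconsE; try exact: measurable_follows;
      try exact: measurable_RV_set1; exact: subIsetr.
  by rewrite P0 measure_le0 => /eqP ->; rewrite mulr0.
have Pf : fine (P (follows e)) != 0.
  by rewrite fine_eq0 // fin_num_measure //; exact: measurable_follows.
apply: (divIf Pf); rewrite mulfK //.
have r := polya_right hY P0; have u := polya_up hY P0.
rewrite take_size in r u; rewrite follows_rcons_step.
by case: b; [rewrite -r | rewrite -u].
Qed.

Definition beta0 : R := beta_int a0.-1 b0.-1.

(** Both sides have the same one-step ratios: those of the walk are given by the urn, those of
    the Beta integral by its recurrence. *)
Lemma prob_follows e : fine (P (follows e)) =
  beta_int (urn a0 b0 e).1.-1 (urn a0 b0 e).2.-1 / beta0.
Proof.
elim/last_ind: e => [|e b IH].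
  have -> : follows [::] = setT.
    by apply/seteqP; split => // w _ i; rewrite leqn0 => /eqP ->;
      rewrite (polya_start hY) /urn /= !addn0.
  by rewrite probability_setT /urn /= !addn0 divff // gt_eqF // beta_int_gt0.
rewrite prob_follows_rcons IH urn_rcons.
have : (0 < (urn a0 b0 e).1)%N by rewrite /= addn_gt0 ha0.
have : (0 < (urn a0 b0 e).2)%N by rewrite /= addn_gt0 hb0.
case: (urn a0 b0 e) => [[|x] [|y]] //= _ _.
have -> : (x.+1 + y.+1 = (x + y).+2)%N by rewrite addSn addnS.
by case: b; rewrite /= ?beta_int_succl ?beta_int_succr mulrA.
Qed.

(** The event that the walk follows [e] and then [N] more steps, the whole path
    satisfying [Q].  Defined by recursion so that measurability and the union bound are immediate. *)
Fixpoint cylinder (N : nat) (e : seq bool) (Q : seq bool -> bool) : set T :=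
  if N is N'.+1 then cylinder N' (rcons e true) Q `|` cylinder N' (rcons e false) Q
  else if Q e then follows e else set0.

Lemma measurable_cylinder N e Q : measurable (cylinder N e Q).
Proof.
elim: N e => [|N IH] e /=; last exact: measurableU.
by case: ifP => // _; exact: measurable_follows.
Qed.

Lemma mem_cylinder N e e' Q w : size e' = N -> follows (e ++ e') w -> Q (e ++ e') ->
  cylinder N e Q w.
Proof.
elim: N e e' => [|N IH] e [|b e'] //=; first by rewrite cats0 => _ h ->.
move=> [se]; rewrite -cat_rcons => h q.
by case: b h q => h q; [left | right]; exact: IH h q.
Qed.

Lemma cylinder_follows N e Q w : cylinder N e Q w ->
  exists e', [/\ size e' = N, follows (e ++ e') w & Q (e ++ e')].
Proof.
elim: N e => [|N IH] e /=; first by case: ifP => // q h; exists [::]; rewrite cats0.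
by case=> /IH[e' [se h q]]; [exists (true :: e') | exists (false :: e')];
  split; rewrite /= ?se // -?cat_rcons.
Qed.

Lemma follows_catl e e' : follows (e ++ e') `<=` follows e.
Proof.
move=> w h i le_i; rewrite h ?takel_cat //.
by rewrite size_cat (leq_trans le_i) // leq_addr.
Qed.

(** No mass is lost by considering only right and up steps, because their two conditional
    probabilities add up to 1. *)
Lemma prob_cylinder_true N e : P (cylinder N e xpredT) = P (follows e).
Proof.
elim: N e => [|N IH] e //=.
have dis : cylinder N (rcons e true) xpredT `&` cylinder N (rcons e false) xpredT = set0.
  apply/seteqP; split => // w [] /cylinder_follows[e1 [_ h1 _]] /cylinder_follows[e2 [_ h2 _]].
  have := follows_catl h1; have := follows_catl h2.
  rewrite !follows_rconsE => -[/= -> _] [/= + _]; rewrite !urn_rcons => -[/esym h _].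
  by move: h; apply/eqP; rewrite -addSn ?eqn_add2r; lia.
transitivity (P (cylinder N (rcons e true) xpredT) + P (cylinder N (rcons e false) xpredT))%E.
  by apply: measureU => //; exact: measurable_cylinder.
rewrite !IH -[RHS]fineK ?fin_num_measure //; last exact: measurable_follows.
rewrite -[X in (X + _)%E]fineK ?fin_num_measure //; last exact: measurable_follows.
rewrite -[X in (_ + X)%E]fineK ?fin_num_measure //; last exact: measurable_follows.
rewrite -EFinD !prob_follows_rcons -mulrDl -mulrDl -natrD divff ?mul1r //.
by rewrite pnatr_eq0 -lt0n addn_gt0 /= addn_gt0 ha0.
Qed.

(** De Finetti's representation as an upper bound: the law of the walk is an average over the
    bias, here weighted by the likelihood of the initial path. *)
Lemma prob_cylinder_le N e Q : (P (cylinder N e Q) <=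
  (unit_integral ('X^((urn a0 b0 e).1.-1) * (1 - 'X) ^+ (urn a0 b0 e).2.-1
     * path_poly N (fun e' => (Q (e ++ e'))%:R)) / beta0)%:E)%E.
Proof.
elim: N e => [|N IH] e /=.
  rewrite cats0; case: ifP => _ /=.
    rewrite polyC1 mulr1 -[leLHS]fineK ?fin_num_measure //; last exact: measurable_follows.
    by rewrite prob_follows.
  by rewrite measure0 polyC0 mulr0 raddf0 mul0r.
apply: le_trans (measureU2 _ _ _) _; try exact: measurable_cylinder.
apply: le_trans (leeD (IH (rcons e true)) (IH (rcons e false))) _.
rewrite -EFinD lee_fin -mulrDl -raddfD !urn_rcons /=.
have -> : (fun e' => (Q (rcons e true ++ e'))%:R) = (fun e' => (Q (e ++ true :: e'))%:R) :> (_ -> R).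
  by apply/funext => e'; rewrite cat_rcons.
have -> : (fun e' => (Q (rcons e false ++ e'))%:R) = (fun e' => (Q (e ++ false :: e'))%:R) :> (_ -> R).
  by apply/funext => e'; rewrite cat_rcons.
have x0 : (0 < a0 + count id e)%N by rewrite addn_gt0 ha0.
have y0 : (0 < b0 + count negb e)%N by rewrite addn_gt0 hb0.
rewrite -{1}(prednK x0) -{2}(prednK y0) /= mulrDr !mulrA.
rewrite (_ : _ * 'X = 'X^((a0 + count id e).-1.+1) * (1 - 'X) ^+ (b0 + count negb e).-1); last first.
  by rewrite exprSr mulrAC.
by rewrite -[_ * (1 - 'X)]mulrA -exprSr.
Qed.

(** The Beta density with integer parameters is at most [1 / B(a0, b0)], so the uniform bias
    dominates. *)
Lemma markov_cylinder N Q (F : seq bool -> R) :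
  (forall e, size e = N -> (Q e)%:R <= F e) ->
  (P (cylinder N [::] Q) <= (unit_integral (path_poly N F) / beta0)%:E)%E.
Proof.
move=> QF; apply: le_trans (prob_cylinder_le _ _ _) _.
have b_gt0 : 0 < beta0 by exact: beta_int_gt0.
rewrite lee_fin ler_pM2r ?invr_gt0 //.
apply: le_unit_integral => a a01; have /andP[a0' a1] := a01.
rewrite !hornerE !horner_path_poly /=.
apply: (@le_trans _ _ (path_mean a N (fun e => (Q e)%:R))); last exact: le_path_mean.
rewrite ler_piMl //.
  by rewrite -(path_mean_cst a N 0); apply: le_path_mean.
by rewrite mulr_ile1 ?exprn_ge0 ?exprn_ile1 ?subr_ge0 // gerBl.
Qed.

Definition walk_path w (i : nat) : bool := (Y i.+1 w).1 != (Y i w).1.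

(** Almost surely all steps go right or up; then a path the walk follows can only be the one
    recording when its first coordinate changes. *)
Lemma ae_follows_walk_path :
  {ae P, forall w, forall n, follows (mkseq (walk_path w) n) w}.
Proof.
have : {ae P, forall w, forall n, cylinder n [::] xpredT w}.
  apply/ae_foralln => n; exists (~` cylinder n [::] xpredT); split.
  - exact: measurableC (measurable_cylinder _ _ _).
  - rewrite [LHS]probability_setC; last exact: measurable_cylinder.
    rewrite prob_cylinder_true -[P _]fineK ?fin_num_measure //; last exact: measurable_follows.
    by rewrite prob_follows /urn /= !addn0 divff ?subee // gt_eqF // beta_int_gt0.
  - by [].
apply: filterS => w h n; have /cylinder_follows[e [/= se he _]] := h n.
suff -> : mkseq (walk_path w) n = e by [].
apply: (@eq_from_nth _ false); first by rewrite size_mkseq.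
move=> i; rewrite size_mkseq => lt_in; rewrite nth_mkseq // /walk_path.
have lt_ie : (i < size e)%N by rewrite se.
rewrite (he i) ?(he i.+1) ?(ltnW lt_ie) // (take_nth false) // urn_rcons.
by case: nth; rewrite /= ?eqxx // -[X in X != _]addn1 -[X in _ != X]addn0 eqn_add2l.
Qed.

End WalkLaw.

(** * Almost every path is eventually typical *)

(** The square of [J^12], since the second moment estimate is for a number of steps that is a
    square.  The exponent is large enough for the union over [m <= J^2] in [prob_atypical] to
    remain summable in [J]. *)
Definition sample_size (J : nat) : nat := ((J ^ 12) ^ 2)%N.

(** Some [m <= J^2] whose visits are not equidistributed, with an error small enough to be
    summed over all these [m], or too many large gcds. *)
Definition atypical (R : realType) (a0 b0 : nat) (eps : R) (J : nat) (e : seq bool) : bool :=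
  has (fun m => eps * (sample_size J)%:R / (J ^ 2)%:R
                < `|path_sum (visit_excess m) a0 (a0 + b0) e|) (iota 1 (J ^ 2))
  || (eps * (sample_size J)%:R < path_sum (large_gcd (J ^ 2)) a0 (a0 + b0) e).

(** With [x = J], the first term is the union bound over [x^2] moduli and the second one is the
    contribution of the large gcds. *)
Lemma sample_size_balance (R : realType) (eps x C : R) : eps != 0 -> x != 0 ->
  x ^+ 2 * ((eps * x ^+ 24 / x ^+ 2) ^- 2 * (21 * x ^+ 2 ^+ 2 * x ^+ 12 ^+ 3))
  + (eps * x ^+ 24)^-1 * (C * x ^+ 24 / x ^+ 2)
  = (21 / eps ^+ 2 + C / eps) / x ^+ 2.
Proof.
move=> eps0 x0; rewrite [RHS]mulrDl; congr (_ + _); last by field; rewrite x0.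
have -> : eps * x ^+ 24 / x ^+ 2 = eps * x ^+ 22 by field.
rewrite exprMn invfM -!exprM /=.
by field; rewrite x0.
Qed.

Section Typicality.
Context d (T : measurableType d) (R : realType) (P : probability T R)
  (Y : nat -> {RV P >-> (nat * nat)%type}) (a0 b0 : nat).
Hypotheses (ha0 : (0 < a0)%N) (hb0 : (0 < b0)%N) (hY : polya_walk Y a0 b0).
Variable eps : R.
Hypothesis eps_gt0 : 0 < eps.

Let bad J := cylinder Y a0 b0 (sample_size J) [::] (atypical a0 b0 eps J).
Let D : R := (21 / eps ^+ 2 + (a0 * (a0 + b0).+1)%:R / eps) / @beta0 R a0 b0.

Lemma path_sum_ge0 (h : nat -> nat -> R) x s e :
  (forall x s, 0 <= h x s) -> 0 <= path_sum h x s e.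
Proof. by move=> h0; elim: e x s => //= b e IH x s; rewrite addr_ge0. Qed.

Lemma prob_atypical J : (0 < J)%N -> (P (bad J) <= (D * (J%:R ^+ 2)^-1)%:E)%E.
Proof.
move=> J0; set N := sample_size J; set M := (J ^ 2)%N; pose q := (J ^ 12)%N.
have J_gt0 : 0 < J%:R :> R by rewrite ltr0n.
have M0 : (0 < M)%N by rewrite expn_gt0 J0.
have q0 : (0 < q)%N by rewrite expn_gt0 J0.
have N0 : (0 < N)%N by rewrite expn_gt0 q0.
have NR : 0 < N%:R :> R by rewrite ltr0n.
have MR : 0 < M%:R :> R by rewrite ltr0n.
pose c : R := eps * N%:R / M%:R.
have c_gt0 : 0 < c by rewrite divr_gt0 // mulr_gt0.
(* A sum of rescaled statistics, at least one of which is 1 or more on an atypical path. *)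
pose F e : R :=
  \sum_(m <- iota 1 M) (c ^+ 2)^-1 * path_sum (visit_excess m) a0 (a0 + b0) e ^+ 2
  + (eps * N%:R)^-1 * path_sum (large_gcd M) a0 (a0 + b0) e.
have large0 e : 0 <= (eps * N%:R)^-1 * path_sum (large_gcd M) a0 (a0 + b0) e.
  by rewrite mulr_ge0 ?invr_ge0 ?(ltW (mulr_gt0 _ _)) // path_sum_ge0.
have small0 e m : 0 <= (c ^+ 2)^-1 * path_sum (visit_excess m) a0 (a0 + b0) e ^+ 2.
  by rewrite mulr_ge0 ?invr_ge0 ?sqr_ge0.
have QF e : size e = N -> (atypical a0 b0 eps J e)%:R <= F e.
  move=> _; rewrite /atypical -/N -/M -/c.
  have [/hasP[m m_in lt_cm]|_] /= := boolP (has _ _).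
    rewrite /F (big_rem m) //= -[leLHS]addr0 -addrA lerD ?addr_ge0 ?sumr_ge0 //.
    rewrite mulrC ler_pdivlMr ?exprn_gt0 // mul1r -[leRHS]real_normK ?num_real //.
    by rewrite ler_sqr ?nnegrE ?normr_ge0 ?(ltW c_gt0) // ltW.
  have [lt_l|_] /= := ltP (eps * N%:R); last by rewrite addr_ge0 // sumr_ge0.
  rewrite /F -[leLHS]add0r lerD ?sumr_ge0 //.
  by rewrite mulrC ler_pdivlMr ?mulr_gt0 // mul1r ltW.
apply: le_trans (markov_cylinder ha0 hb0 hY QF) _.
rewrite lee_fin /D mulrAC ler_pM2r ?invr_gt0 ?beta_int_gt0 //.
rewrite path_polyD path_poly_sum path_polyZ raddfD raddf_sum /= unit_integralZ.
have sqr_le : \sum_(m <- iota 1 M) unit_integral (path_poly N (fun e =>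
     (c ^+ 2)^-1 * path_sum (visit_excess m) a0 (a0 + b0) e ^+ 2)) <=
     \sum_(m <- iota 1 M) (c ^+ 2)^-1 * (21 * M%:R ^+ 2 * q%:R ^+ 3).
  rewrite [leLHS]big_seq [leRHS]big_seq; apply: ler_sum => m.
  rewrite mem_iota => /andP[m0 le_mM]; rewrite path_polyZ unit_integralZ.
  rewrite ler_wpM2l ?invr_ge0 ?sqr_ge0 //.
  apply: le_trans (integral_sqr_visit_excess a0 (a0 + b0) m0 q0) _.
  rewrite ler_wpM2r ?exprn_ge0 // ler_pM2l // ler_sqr ?nnegrE // ler_nat; lia.
have large_le := ler_wpM2l (_ : 0 <= (eps * N%:R)^-1)
  (@integral_large_gcd R M N a0 (a0 + b0) M0 N0 ha0).
apply: le_trans (lerD sqr_le (large_le _)) _.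
  by rewrite invr_ge0 ltW // mulr_gt0.
rewrite big_const_seq count_predT size_iota iter_addr_0 -(mulr_natl (c ^- 2 * _)).
have NE : N%:R = J%:R ^+ 24 :> R by rewrite -natrX /N /sample_size -expnM.
have ME : M%:R = J%:R ^+ 2 :> R by rewrite /M natrX.
have qE : q%:R = J%:R ^+ 12 :> R by rewrite /q natrX.
rewrite /c NE ME qE.
by rewrite sample_size_balance // gt_eqF.
Qed.

Lemma ae_eventually_typical :
  {ae P, forall w, exists j0, forall J, (j0 <= J)%N ->
     ~~ atypical a0 b0 eps J (mkseq (walk_path Y w) (sample_size J))}.
Proof.
pose B j := bad j.+1.
have mB j : measurable (B j) by exact: measurable_cylinder.
have D0 : 0 <= D.
  rewrite /D divr_ge0 ?(ltW (beta_int_gt0 _ _)) // addr_ge0 // divr_ge0 ?ler0n //.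
    exact: sqr_ge0.
  exact: ltW.
have BC : P (lim_sup_set B) = 0%E.
  apply: lim_sup_set_cvg0 => //.
  apply: (@le_lt_trans _ _ (D * 2)%:E); last exact: ltry.
  apply: lime_le; first by apply: is_cvg_nneseries => *; exact: measure_ge0.
  apply: nearW => n.
  apply: (@le_trans _ _ (\sum_(0 <= i < n) (D * (i.+1%:R ^+ 2)^-1)%:E)%E).
    by apply: lee_sum => i _; exact: prob_atypical.
  rewrite sumEFin lee_fin -mulr_sumr ler_wpM2l //.
  case: n => [|n]; first by rewrite big_geq.
  rewrite big_nat_recl //= expr1n invr1 -[leRHS](_ : 1 + 1 = _) // lerD2l.
  have := @sum_inv_sqr_le R 1 n.+2 isT; rewrite invr1; congr (_ <= _).
  by rewrite !big_add1.
have : {ae P, forall w, ~ lim_sup_set B w}.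
  exists (lim_sup_set B); split=> //.
  - by apply: bigcap_measurable => // n _; exact: bigcup_measurable.
  - by move=> w /=; rewrite notK.
move=> h; have h2 := ae_follows_walk_path ha0 hb0 hY.
apply: filterS2 h h2 => w nB fw.
have [j0 hj0] : exists j0, forall j, (j0 <= j)%N -> ~ B j w.
  move: nB; rewrite /lim_sup_set /bigcap /= => /existsNP[j0 /not_implyP[_ nb]].
  by exists j0 => j le_j Bj; apply: nb; exists j.
exists j0.+1 => -[//|J] lt_J; apply/negP => at_J.
apply: (hj0 J) => //; apply: (@mem_cylinder _ _ _ _ _ _ _ _ _ (mkseq (walk_path Y w) (sample_size J.+1))).
- by rewrite size_mkseq.
- exact: fw.
- exact: at_J.
Qed.

End Typicality.

(** * The sieve by primes and the Euler product for zeta(2) *)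

Section EulerSieve.
Context {R : realType}.

Definition coprime_to (ps : seq nat) (n : nat) : bool := all (fun p => ~~ (p %| n)%N) ps.

Definition euler_factor (ps : seq nat) : R := \prod_(p <- ps) (1 - (p%:R ^+ 2)^-1).

Lemma euler_factor_cons p ps :
  euler_factor (p :: ps) = (1 - (p%:R ^+ 2)^-1) * euler_factor ps.
Proof. exact: big_cons. Qed.

Lemma coprime_to_mul ps p n : all prime ps -> prime p -> p \notin ps ->
  coprime_to ps (p * n) = coprime_to ps n.
Proof.
move=> prps prp pNps; apply: eq_in_all => q q_in; congr (~~ _).
have prq : prime q by exact: (allP prps).
rewrite Gauss_dvdr // prime_coprime // dvdn_prime2 //.
by apply: contraNneq pNps => <-.
Qed.

(** Partial sums of the part of the series of [zeta 2] over the integers with no prime factor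
    in [ps]. *)
Definition zeta_sieved (ps : seq nat) (K : nat) : R :=
  \sum_(1 <= i < K.+1) (coprime_to ps i)%:R / i%:R ^+ 2.

Lemma sum_multiples (phi : nat -> R) p K : (0 < p)%N ->
  \sum_(1 <= i < K.+1) (p %| i)%N%:R * phi i =
  \sum_(1 <= j < (K %/ p).+1) phi (p * j)%N.
Proof.
move=> p0; elim: K => [|K IH]; first by rewrite div0n !big_geq.
rewrite big_nat_recr //= IH divnS //.
have [dv|_] := boolP (p %| K.+1)%N; last by rewrite mul0r addr0 add0n.
rewrite mul1r add1n [RHS]big_nat_recr //=; congr (_ + phi _).
have := divnS K p0; rewrite dv add1n => <-.
by rewrite mulnC divnK.
Qed.

(** Removing the multiples of [p] removes a copy of the series scaled by [1 / p^2]. *)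
Lemma zeta_sieved_cons p ps K : all prime ps -> prime p -> p \notin ps ->
  zeta_sieved (p :: ps) K = zeta_sieved ps K - (p%:R ^+ 2)^-1 * zeta_sieved ps (K %/ p).
Proof.
move=> prps prp pNps; have p0 := prime_gt0 prp.
have := sum_multiples (fun i => (coprime_to ps i)%:R / i%:R ^+ 2) K p0.
have -> : \sum_(1 <= j < (K %/ p).+1) (coprime_to ps (p * j))%:R / (p * j)%:R ^+ 2
    = (p%:R ^+ 2)^-1 * zeta_sieved ps (K %/ p).
  rewrite mulr_sumr; apply: eq_bigr => j _.
  by rewrite coprime_to_mul // natrM exprMn invfM mulrCA.
move=> <-; rewrite -sumrB; apply: eq_bigr => i _ /=.
by case: (p %| i)%N; rewrite /= ?mul0r ?mul1r ?subrr ?subr0.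
Qed.

Lemma zeta2E : zeta (2 : R) = limn (zeta_sieved [::]).
Proof.
rewrite /zeta; congr (limn _); apply/funext => K.
rewrite /series /= /zeta_sieved big_add1 /=; apply: eq_bigr => i _.
by rewrite div1r powRN powR_mulrn.
Qed.

Lemma cvg_zeta2 : zeta_sieved [::] @ \oo --> zeta (2 : R).
Proof.
rewrite zeta2E; apply: nondecreasing_is_cvgn.
  apply/nondecreasing_seqP => K; rewrite /zeta_sieved [leRHS]big_nat_recr //=.
  by rewrite lerDl divr_ge0 ?exprn_ge0.
exists 2 => _ [[|K] _ <-]; first by rewrite /zeta_sieved big_geq.
rewrite /zeta_sieved big_ltn // expr1n divr1.
rewrite -[leRHS](_ : 1 + 1 = _) // lerD2l.
have := @sum_inv_sqr_le R 1 K.+2 isT; rewrite invr1; congr (_ <= _).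
by apply: eq_bigr => i _; rewrite div1r.
Qed.

Lemma cvg_divn p : (0 < p)%N -> (fun K => K %/ p)%N @ \oo --> \oo.
Proof.
move=> p0; apply/cvgnyPge => A; exists (A * p)%N => // K /= le_K.
by rewrite leq_divRL.
Qed.

Lemma cvg_zeta_sieved ps : uniq ps -> all prime ps ->
  zeta_sieved ps @ \oo --> zeta (2 : R) * euler_factor ps.
Proof.
elim: ps => [|p ps IH]; first by rewrite /euler_factor big_nil mulr1 => _ _; exact: cvg_zeta2.
rewrite cons_uniq /= => /andP[pNps ups] /andP[prp prps].
have h := IH ups prps.
rewrite (funext (fun K => zeta_sieved_cons K prps prp pNps)).
rewrite euler_factor_cons mulrCA mulrBl mul1r.
apply: cvgB => //; apply: cvgM; first exact: cvg_cst.
exact: (@cvg_comp _ _ _ (fun K => K %/ p)%N (zeta_sieved ps) _ _ _ (cvg_divn (prime_gt0 prp)) h).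
Qed.

Definition small_primes z := [seq p <- iota 0 z.+1 | prime p].

Lemma uniq_small_primes z : uniq (small_primes z).
Proof. by rewrite filter_uniq // iota_uniq. Qed.

Lemma all_small_primes z : all prime (small_primes z).
Proof. exact: filter_all. Qed.

Lemma coprime_small_primes z n : (0 < n)%N -> coprime_to (small_primes z) n ->
  (n == 1)%N || (z < n)%N.
Proof.
move=> n0 /allP cop; have [-> //|n1 /=] := eqVneq n 1%N.
rewrite ltnNge; apply/negP => le_nz.
have n_gt1 : (1 < n)%N by case: n n0 n1 {cop le_nz} => [|[]].
have /cop : pdiv n \in small_primes z.
  by rewrite mem_filter pdiv_prime // mem_iota /= ltnS (leq_trans (pdiv_leq n0)).
by rewrite pdiv_dvd.
Qed.

(** After sieving by the primes up to [z], the remaining terms of the series are the term 1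
    and terms of index larger than [z]. *)
Lemma euler_factor_bounds z : (0 < z)%N ->
  1 <= zeta (2 : R) * euler_factor (small_primes z) <= 1 + z%:R^-1.
Proof.
move=> z0; have := cvg_zeta_sieved (uniq_small_primes z) (all_small_primes z).
set l := _ * _ => cl.
have split1 K : zeta_sieved (small_primes z) K.+1 =
    1 + \sum_(2 <= i < K.+2) (coprime_to (small_primes z) i)%:R / i%:R ^+ 2.
  rewrite /zeta_sieved big_ltn // expr1n divr1; congr (_ + _).
  have -> // : coprime_to (small_primes z) 1.
  by apply/allP => p; rewrite mem_filter dvdn1 => /andP[/prime_gt1]; case: p => [|[]].
have term0 i : 0 <= (coprime_to (small_primes z) i)%:R / i%:R ^+ 2 :> R.
  by rewrite divr_ge0 ?exprn_ge0.
apply/andP; split.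
  apply: (cvgr_to_ge cl); exists 1%N => // -[//|K] _ /=.
  by rewrite split1 lerDl sumr_ge0.
apply: (cvgr_to_le cl); exists 1%N => // -[//|K] _ /=.
rewrite split1 lerD2l; apply: le_trans (sum_inv_sqr_le (maxn K.+2 z.+1) z0).
have le1 i : (1 < i)%N -> (coprime_to (small_primes z) i)%:R / i%:R ^+ 2
    <= (z < i)%N%:R * (i%:R ^+ 2)^-1 :> R.
  move=> i1; rewrite ler_wpM2r ?invr_ge0 ?exprn_ge0 //.
  have [/coprime_small_primes h|_] := boolP (coprime_to _ _); last by [].
  by have := h (ltnW i1); case: eqP i1 => [->//|_ _ /= ->].
apply: (@le_trans _ _ (\sum_(2 <= i < maxn K.+2 z.+1) (z < i)%N%:R * (i%:R ^+ 2)^-1)).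
  rewrite [leRHS](@big_cat_nat _ _ _ K.+2) ?leq_maxl //=.
  rewrite -[leLHS]addr0 lerD //; last by apply: sumr_ge0 => i _; rewrite mulr_ge0 ?invr_ge0.
  by rewrite big_nat [leRHS]big_nat; apply: ler_sum => i /andP[i1 _]; exact: le1.
rewrite (@big_cat_nat _ _ _ z.+1) ?leq_maxr ?ltnS //= big_nat big1 ?add0r.
  by rewrite big_nat [leRHS]big_nat; apply: ler_sum => i /andP[-> _]; rewrite mul1r.
by move=> i /andP[_]; rewrite ltnS leqNgt => /negbTE ->; rewrite mul0r.
Qed.

Lemma zeta2_ge1 : 1 <= zeta (2 : R).
Proof.
apply: (cvgr_to_ge cvg_zeta2); exists 1%N => // K /= K1.
rewrite /zeta_sieved big_ltn // expr1n divr1 lerDl; apply: sumr_ge0 => i _.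
by rewrite divr_ge0 ?exprn_ge0.
Qed.

Lemma euler_factor_dist z : (0 < z)%N ->
  `|(zeta (2 : R))^-1 - euler_factor (small_primes z)| <= z%:R^-1.
Proof.
move=> z0; have /andP[lo hi] := euler_factor_bounds z0.
have z1 := zeta2_ge1; have zp : 0 < zeta (2 : R) by apply: lt_le_trans z1.
have zi : 0 <= z%:R^-1 :> R by rewrite invr_ge0.
have -> : (zeta (2 : R))^-1 - euler_factor (small_primes z)
  = (1 - zeta 2 * euler_factor (small_primes z)) / zeta 2.
  by field; rewrite gt_eqF.
rewrite normrM normfV (gtr0_norm zp) ler_pdivrMr // -[leLHS]mul1r mulrC.
apply: ler_pM => //.
by rewrite ler_norml; lra.
Qed.

End EulerSieve.

(** * Frequencies of exact values from frequencies of multiples *)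

Section Frequencies.
Context {R : realType}.
Variable g : nat -> nat.
Hypothesis g_gt0 : forall n, (0 < g n)%N.

Definition frequency (N : nat) (p : pred nat) : R :=
  N%:R^-1 * \sum_(1 <= n < N.+1) (p (g n))%:R.

Lemma le_frequency N (p q : pred nat) : (forall n, (0 < n)%N -> p n -> q n) ->
  frequency N p <= frequency N q.
Proof.
move=> le_pq; rewrite ler_wpM2l ?invr_ge0 //; apply: ler_sum => n _.
by have := le_pq _ (g_gt0 n); case: (p _) => // /(_ isT) ->.
Qed.

Lemma frequencyD N (p q r : pred nat) :
  (forall n, (0 < n)%N -> (p n)%:R = (q n)%:R + (r n)%:R :> R) ->
  frequency N p = frequency N q + frequency N r.
Proof.
move=> pqr; rewrite /frequency -mulrDr -big_split /=; congr (_ * _).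
by apply: eq_bigr => n _; rewrite pqr.
Qed.

(** [n] is [k] times a number with no prime factor in [ps]. *)
Definition sieved k ps n := (k %| n)%N && coprime_to ps (n %/ k).

(** The inclusion-exclusion step: among the numbers [k r] with [r] free of [ps], those with
    [p] dividing [r] are the numbers [k p r'] with [r'] free of [ps]. *)
Lemma sieved_cons k p ps n : (0 < k)%N -> all prime ps -> prime p -> p \notin ps ->
  (sieved k ps n)%:R = (sieved k (p :: ps) n)%:R + (sieved (k * p) ps n)%:R :> R.
Proof.
move=> k0 prps prp pNps; rewrite /sieved.
have [/dvdnP[m ->{n}]|kNn] /= := boolP (k %| n)%N; last first.
  rewrite (_ : (k * p %| n)%N = false) ?addr0 //.
  by apply: contraNF kNn; apply: dvdn_trans; exact: dvdn_mulr.
rewrite mulnK // [(k * p)%N]mulnC dvdn_pmul2r //.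
have [/dvdnP[r ->{m}]|_] /= := boolP (p %| m)%N; last by rewrite addr0.
rewrite -mulnA mulnK ?muln_gt0 ?k0 ?prime_gt0 //.
by rewrite mulnC coprime_to_mul // add0r.
Qed.

Lemma le_frequencyU N (p q r : pred nat) :
  (forall n, (0 < n)%N -> p n -> q n || r n) ->
  frequency N p <= frequency N q + frequency N r.
Proof.
move=> pqr; rewrite /frequency -mulrDr -big_split /=.
rewrite ler_wpM2l ?invr_ge0 //; apply: ler_sum => n _.
have := pqr _ (g_gt0 n); case: (p _) => [/(_ isT)|_]; last by rewrite addr_ge0.
by case: (q _) => [_|/= ->]; rewrite ?lerDl // add0r.
Qed.

Variable size_of : nat -> nat.
Hypothesis cvg_multiples : forall m, (0 < m)%N ->
  (fun J => frequency (size_of J) (fun n => m %| n)%N) @ \oo --> ((m%:R ^+ 2)^-1 : R).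
Hypothesis tail_le : forall z e, (0 < z)%N -> 0 < e ->
  \forall J \near \oo, frequency (size_of J) (fun n => z < n)%N <= z%:R^-1 + e.

Lemma cvg_sieved ps k : uniq ps -> all prime ps -> (0 < k)%N ->
  (fun J => frequency (size_of J) (sieved k ps)) @ \oo
    --> (k%:R ^+ 2)^-1 * euler_factor ps.
Proof.
elim: ps k => [|p ps IH] k; first last.
  rewrite cons_uniq /= => /andP[pNps ups] /andP[prp prps] k0.
  have kp0 : (0 < k * p)%N by rewrite muln_gt0 k0 prime_gt0.
  have -> : (fun J => frequency (size_of J) (sieved k (p :: ps))) =
    (fun J => frequency (size_of J) (sieved k ps) - frequency (size_of J) (sieved (k * p) ps)).
    apply/funext => J; rewrite (@frequencyD _ (sieved k ps) (sieved k (p :: ps)) (sieved (k * p) ps)) ?addrK //.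
    by move=> n _; exact: sieved_cons.
  rewrite (_ : _ * _ = (k%:R ^+ 2)^-1 * euler_factor ps - ((k * p)%:R ^+ 2)^-1 * euler_factor ps).
    by apply: cvgB; exact: IH.
  by rewrite euler_factor_cons natrM exprMn (invfM (k%:R ^+ 2)); ring.
move=> _ _ k0; rewrite /euler_factor big_nil mulr1.
have -> : (fun J => frequency (size_of J) (sieved k [::])) =
   (fun J => frequency (size_of J) (fun n => k %| n)%N).
  apply/funext => J; congr (_ * _); apply: eq_bigr => n _.
  by rewrite /sieved /= andbT.
exact: cvg_multiples.
Qed.

(** [n = k] implies that [n] is sieved, and a sieved [n] other than [k] is larger than the
    sieving bound [z]; so sieving computes the frequency of [k] up to the tail frequency. *)
Lemma cvg_frequency_eq k : (0 < k)%N ->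
  (fun J => frequency (size_of J) (pred1 k)) @ \oo --> 1 / (k%:R ^+ 2 * zeta (2 : R)).
Proof.
move=> k0; apply/cvgrPdist_le => e e0.
have e4 : 0 < e / 4 by rewrite divr_gt0.
(* A quarter of the error goes to each of the sieve limit, the Euler factor and the two terms
   of the tail bound. *)
have [z z0 ze] : exists2 z, (0 < z)%N & z%:R^-1 <= e / 4.
  have [z _ hz] := nbhs_infty_ger ((e / 4)^-1).
  exists z.+1 => //; rewrite invf_ple ?posrE ?ltr0n //.
  by apply: hz; rewrite /= leqnSn.
have sv := cvg_sieved (uniq_small_primes z) (all_small_primes z) k0.
have k2 : (k%:R ^+ 2)^-1 <= 1 :> R.
  by rewrite invf_le1 ?exprn_gt0 ?ltr0n // expr_ge1 ?ler0n // ler1n.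
have k2p : 0 <= (k%:R ^+ 2)^-1 :> R by rewrite invr_ge0 exprn_ge0.
move/cvgrPdist_le : sv => /(_ _ e4).
apply: filterS2 (tail_le z0 e4) => J tail sv.
have up : frequency (size_of J) (pred1 k) <= frequency (size_of J) (sieved k (small_primes z)).
  apply: le_frequency => n n0 /eqP ->; rewrite /sieved dvdnn divnn k0 /=.
  by apply/allP => p; rewrite mem_filter dvdn1 => /andP[/prime_gt1]; case: p => [|[]].
have lo : frequency (size_of J) (sieved k (small_primes z)) <=
   frequency (size_of J) (pred1 k) + frequency (size_of J) (fun n => z < n)%N.
  apply: le_frequencyU => n n0 /andP[/dvdnP[m nE]]; rewrite {}nE in n0 *; rewrite mulnK //.
  move: n0; rewrite muln_gt0 => /andP[m0 _] /(coprime_small_primes m0) /orP[/eqP->|lt_zm].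
    by rewrite /= mul1n eqxx.
  by rewrite (leq_trans lt_zm) ?orbT // leq_pmulr.
have ed := @euler_factor_dist R z z0.
have c1 : `|1 / (k%:R ^+ 2 * zeta 2) - (k%:R ^+ 2)^-1 * euler_factor (small_primes z)| <= e / 4.
  rewrite (_ : _ - _ = (k%:R ^+ 2)^-1 * ((zeta 2)^-1 - euler_factor (small_primes z))); last first.
    by rewrite mulrBr div1r invfM.
  rewrite normrM ger0_norm // -[leRHS]mul1r ler_pM //; exact: le_trans ed ze.
have e4E : e = e / 4 * 4 by rewrite divfK.
move: tail sv up lo c1 e4E; move: (e / 4) (frequency _ _) (frequency _ _) (frequency _ _) (_ / _) (_ * _).
move=> e' t s f a b; rewrite !ler_norml => *.
lra.
Qed.

End Frequencies.

(** * From a sparse sequence of times to all times *)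

Section Interpolation.
Context {R : realType}.
Variables (g : nat -> nat) (p : pred nat).
Local Notation freq := (@frequency R g).

Lemma sample_sizeE J : sample_size J = (J ^ 24)%N.
Proof. by rewrite /sample_size -expnM. Qed.

Lemma sample_size_ratio J :
  (sample_size J.+1)%:R / (sample_size J)%:R = (J.+1%:R / J%:R) ^+ 24 :> R.
Proof. by rewrite !sample_sizeE !natrX exprMn exprVn. Qed.

Lemma cvg_sample_size_ratio :
  (fun J => (sample_size J.+1)%:R / (sample_size J)%:R : R) @ \oo --> (1 : R).
Proof.
have cvg1 : (fun J => J.+1%:R / J%:R : R) @ \oo --> (1 : R).
  rewrite -(cvg_shiftS (fun J => J.+1%:R / J%:R : R)) /=.
  have -> : (fun J => J.+2%:R / J.+1%:R : R) = (fun J => 1 + harmonic J).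
    apply/funext => J; rewrite /= -[J.+2]addn1 natrD mulrDl divff ?mul1r //.
  have : (fun J => 1 + harmonic J) @ \oo --> (1 + 0 : R).
    by apply: cvgD; [exact: cvg_cst|exact: cvg_harmonic].
  by rewrite addr0.
have := continuous_cvg _ (@exprn_continuous R 24 1) cvg1.
by rewrite expr1n (funext sample_size_ratio); apply.
Qed.

Lemma sample_size_bracket N : (0 < N)%N ->
  exists J, (sample_size J <= N < sample_size J.+1)%N.
Proof.
move=> N0; have ex : exists J, (sample_size J <= N)%N by exists 0%N.
have ub J : (sample_size J <= N)%N -> (J <= N)%N.
  by apply: leq_trans; rewrite sample_sizeE; case: J => // J; rewrite -[leqLHS]expn1 leq_pexp2l.
exists (ex_maxn ex ub); case: ex_maxnP => J -> max_J /=.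
by rewrite ltnNge; apply/negP => /max_J; rewrite ltnn.
Qed.

Lemma leq_sample_size : {homo sample_size : J J' / (J <= J')%N}.
Proof. by move=> J J' le_J; rewrite !sample_sizeE leq_exp2r. Qed.

(** The counts are monotone in [N], and each [N] lies between two consecutive sample sizes,
    whose ratio tends to 1. *)
Lemma cvg_frequency_sample_size (l : R) :
  (fun J => freq (sample_size J) p) @ \oo --> l -> (fun N => freq N p) @ \oo --> l.
Proof.
move=> ul; pose a N : R := \sum_(1 <= n < N.+1) (p (g n))%:R.
have a_homo : {homo a : m n / (m <= n)%N >-> m <= n}.
  by apply/nondecreasing_seqP => n; rewrite /a [leRHS]big_nat_recr //= lerDl.
have a_ge0 n : 0 <= a n by apply: sumr_ge0.
pose r J : R := (sample_size J.+1)%:R / (sample_size J)%:R.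
have cr : r @ \oo --> (1 : R) := cvg_sample_size_ratio.
have cl : (fun J => freq (sample_size J) p * (r J)^-1) @ \oo --> l.
  rewrite -[l]mulr1 -[X in _ * X]invr1; apply: cvgM => //.
  by apply: cvgV => //; rewrite oner_eq0.
have cu : (fun J => freq (sample_size J.+1) p * r J) @ \oo --> l.
  rewrite -[l]mulr1; apply: cvgM => //.
  by rewrite (cvg_shiftS (fun J => freq (sample_size J) p)).
apply/cvgrPdist_le => e e0.
move/cvgrPdist_le : cl => /(_ _ e0)[J1 _ lo]; move/cvgrPdist_le : cu => /(_ _ e0)[J2 _ up].
pose J0 := maxn 1 (maxn J1 J2).
exists (sample_size J0) => // N /= le_JN.
have N0 : (0 < N)%N by apply: leq_trans le_JN; rewrite sample_sizeE expn_gt0 leq_max.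
have [J /andP[le_N lt_N]] := sample_size_bracket N0.
have le_J : (J0 <= J)%N.
  by rewrite -ltnS ltnNge; apply/negP => /leq_sample_size le_J'; move: lt_N; rewrite ltnNge (leq_trans le_J').
have Jpos : (0 < J)%N by apply: leq_trans le_J; rewrite leq_max.
have S0 : (0 < sample_size J)%N by rewrite sample_sizeE expn_gt0 Jpos.
have S1 : (0 < sample_size J.+1)%N by rewrite sample_sizeE expn_gt0.
have {lo}lo : `|l - freq (sample_size J) p * (r J)^-1| <= e.
  by apply: lo; rewrite /= (leq_trans _ le_J) // !leq_max leqnn orbT.
have {up}up : `|l - freq (sample_size J.+1) p * r J| <= e.
  by apply: up; rewrite /= (leq_trans _ le_J) // !leq_max leqnn !orbT.
have ge : freq (sample_size J) p * (r J)^-1 <= freq N p.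
  have -> : freq (sample_size J) p * (r J)^-1 = (sample_size J.+1)%:R^-1 * a (sample_size J).
    by rewrite /frequency -/(a _) /r; field; rewrite !pnatr_eq0 -!lt0n S0 S1.
  rewrite /frequency -/(a N) ler_pM ?invr_ge0 //; last exact: a_homo.
  by rewrite lef_pV2 ?posrE ?ltr0n // ler_nat ltnW.
have le : freq N p <= freq (sample_size J.+1) p * r J.
  have -> : freq (sample_size J.+1) p * r J = (sample_size J)%:R^-1 * a (sample_size J.+1).
    by rewrite /frequency -/(a _) /r; field; rewrite !pnatr_eq0 -!lt0n S0 S1.
  rewrite /frequency -/(a N) ler_pM ?invr_ge0 //; last exact: a_homo (ltnW lt_N).
  by rewrite lef_pV2 ?posrE ?ltr0n // ler_nat.
by move: lo up; rewrite !ler_norml; lra.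
Qed.

End Interpolation.

(** * Frequencies of gcds along a typical path *)

Section TypicalPaths.
Context {R : realType}.
Variables (a0 b0 : nat) (f : nat -> bool).
Hypothesis ha0 : (0 < a0)%N.

Lemma path_sum_rcons (h : nat -> nat -> R) x s e b : path_sum h x s (rcons e b) =
  path_sum h x s e + h (x + count id (rcons e b))%N (s + size e).+1.
Proof.
elim: e x s => [|c e IH] x s /=; first by rewrite !addn0 addr0 add0r.
by rewrite IH addrA addnA addSnnS.
Qed.

Lemma path_sum_mkseq (h : nat -> nat -> R) x s N : path_sum h x s (mkseq f N) =
  \sum_(1 <= n < N.+1) h (x + count id (mkseq f n))%N (s + n)%N.
Proof.
elim: N => [|N IH]; first by rewrite big_geq.
by rewrite mkseqS path_sum_rcons -mkseqS IH [RHS]big_nat_recr //= size_mkseq addnS.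
Qed.

Definition gcd_along (n : nat) : nat := gcdn (a0 + count id (mkseq f n)) (a0 + b0 + n).
Local Notation freq := (@frequency R gcd_along).

Lemma gcd_along_gt0 n : (0 < gcd_along n)%N.
Proof. by rewrite gcdn_gt0 !addn_gt0 ha0. Qed.

Lemma count_multiples_dist s N m : (0 < m)%N ->
  `|(\sum_(1 <= n < N.+1) (m %| s + n)%N)%:R * m%:R - N%:R| <= m%:R :> R.
Proof.
move=> m0; have : ((\sum_(1 <= n < N.+1) (m %| s + n)) + s %/ m = (s + N) %/ m)%N.
  elim: N => [|N IH]; first by rewrite big_geq // addn0.
  by rewrite big_nat_recr //= addnAC IH addnS divnS // addnC.
set c := (\sum_(_ <= _ < _) _)%N => cE.
have := divn_eq (s + N) m; rewrite -cE mulnDl.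
have := divn_eq s m; have := ltn_pmod s m0; have := ltn_pmod (s + N) m0.
move: (s %/ m * m)%N (s %% m)%N ((s + N) %% m)%N => u r1 r2 lt2 lt1 e1 e2.
have h1 : (c * m <= N + m)%N by lia.
have h2 : (N <= c * m + m)%N by lia.
move: h1 h2; rewrite -!(ler_nat R) !natrD natrM => h1 h2.
by rewrite ler_norml; lra.
Qed.

(** The times with [m %| s_n] have frequency [1 / m] up to [1 / N], and the excess measures the
    deviation of the visits from the proportion [1 / m] of these times. *)
Lemma frequency_dvdn_dist N m c : (0 < N)%N -> (0 < m)%N ->
  `|path_sum (visit_excess m) a0 (a0 + b0) (mkseq f N)| <= c * N%:R ->
  `|(m%:R ^+ 2)^-1 - freq N (fun n => m %| n)%N| <= c + N%:R^-1.
Proof.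
move=> N0 m0; rewrite path_sum_mkseq; set V := \sum_(_ <= _ < _) _ => V_le.
have NR : 0 < N%:R :> R by rewrite ltr0n.
have mR : 1 <= m%:R :> R by rewrite ler1n.
have mR0 : 0 < m%:R :> R by rewrite ltr0n.
have := count_multiples_dist (a0 + b0) N m0.
set k := (\sum_(_ <= _ < _) _)%N => k_le.
have VE : V = N%:R * freq N (fun n => m %| n)%N - k%:R / m%:R.
  rewrite /V /frequency mulVKf ?gt_eqF // /k natr_sum mulr_suml -sumrB.
  apply: eq_bigr => n _; rewrite /visit_excess /gcd_along dvdn_gcd mulrBr; congr (_ - _).
  by rewrite -natrM mulnb andbC.
have -> : (m%:R ^+ 2)^-1 - freq N (fun n => m %| n)%N =
   - (N%:R^-1 * (V + (k%:R * m%:R - N%:R) / m%:R ^+ 2)).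
  by rewrite VE; field; rewrite !gt_eqF.
rewrite normrN normrM gtr0_norm ?invr_gt0 // mulrC ler_pdivrMr // [(c + _) * _]mulrDl mulVf ?gt_eqF //.
apply: le_trans (ler_normD _ _) _; apply: lerD => //.
rewrite normrM normfV (gtr0_norm (exprn_gt0 2 mR0)) ler_pdivrMr ?exprn_gt0 // mul1r.
by apply: le_trans k_le _; rewrite expr2 ler_peMr // ltW.
Qed.

Hypothesis typical : forall k : nat, exists j0, forall J, (j0 <= J)%N ->
  ~~ atypical a0 b0 (k.+1%:R^-1 : R) J (mkseq f (sample_size J)).

Lemma typical_eps (eps : R) : 0 < eps -> \forall J \near \oo,
  [/\ (0 < J)%N, J%:R^-1 <= eps,
      forall m, (0 < m <= J ^ 2)%N ->
        `|(m%:R ^+ 2)^-1 - freq (sample_size J) (fun n => m %| n)%N|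
          <= eps / (J ^ 2)%:R + (sample_size J)%:R^-1 &
      freq (sample_size J) (fun n => J ^ 2 < n)%N <= eps].
Proof.
move=> eps0; have [k _ hk] := nbhs_infty_ger (eps^-1).
have k_le : k.+1%:R^-1 <= eps.
  by rewrite invf_ple ?posrE ?ltr0n //; apply: hk; rewrite /= leqnSn.
have [j0 hj] := typical k.
exists (maxn j0 k.+1) => // J /=; rewrite geq_max => /andP[le_j le_k].
have J0 : (0 < J)%N by apply: leq_trans le_k.
have S0 : (0 < sample_size J)%N by rewrite sample_sizeE expn_gt0 J0.
have SR : 0 < (sample_size J)%:R :> R by rewrite ltr0n.
have := hj J le_j; rewrite negb_or => /andP[/hasPn small]; rewrite -leNgt => large.
split=> //.
- by apply: le_trans k_le; rewrite lef_pV2 ?posrE ?ltr0n // ler_nat.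
- move=> m /andP[m0 le_m].
  have := small m; rewrite mem_iota m0 add1n ltnS le_m -leNgt => /(_ isT) h.
  apply: frequency_dvdn_dist => //; apply: le_trans h _.
  by rewrite mulrAC ler_wpM2r // ler_wpM2r ?invr_ge0.
- rewrite /frequency mulrC ler_pdivrMr //.
  apply: le_trans (_ : k.+1%:R^-1 * (sample_size J)%:R <= _); last by rewrite ler_wpM2r // ltW.
  by apply: le_trans large; rewrite path_sum_mkseq.
Qed.

Lemma inv_sample_size_le J : (0 < J)%N -> (sample_size J)%:R^-1 <= J%:R^-1 :> R.
Proof.
move=> J0; rewrite lef_pV2 ?posrE ?ltr0n ?sample_sizeE ?expn_gt0 ?J0 // ler_nat.
by rewrite -[leqLHS]expn1 leq_pexp2l.
Qed.

Lemma cvg_frequency_dvdn m : (0 < m)%N ->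
  (fun J => freq (sample_size J) (fun n => m %| n)%N) @ \oo --> ((m%:R ^+ 2)^-1 : R).
Proof.
move=> m0; apply/cvgrPdist_le => e e0; have e2 : 0 < e / 2 by rewrite divr_gt0.
apply: filterS2 (nbhs_infty_ge m) (typical_eps e2) => J /= le_mJ [J0 Je small _].
have J2 : (J <= J ^ 2)%N by rewrite -[leqLHS]expn1 leq_pexp2l.
apply: le_trans (small m _) _; first by rewrite m0 (leq_trans le_mJ).
rewrite [leRHS]splitr; apply: lerD; last exact: le_trans (inv_sample_size_le J0) Je.
by rewrite ler_pdivrMr ?ltr0n ?expn_gt0 ?J0 // ler_peMr ?(ltW e2) // ler1n expn_gt0 J0.
Qed.

(** A gcd larger than [z] is either larger than [J^2] or equal to some [m] between [z] and
    [J^2]; the frequencies of multiples of these [m] add up to at most about [1 / z], the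
    errors being small enough to be added [J^2] times. *)
Lemma frequency_tail z e : (0 < z)%N -> 0 < e ->
  \forall J \near \oo, freq (sample_size J) (fun n => z < n)%N <= z%:R^-1 + e.
Proof.
move=> z0 e0; have e3 : 0 < e / 3 by rewrite divr_gt0.
apply: filterS (typical_eps e3) => J [J0 Je small large].
have SR : 0 < (sample_size J)%:R :> R by rewrite ltr0n sample_sizeE expn_gt0 J0.
set M := (J ^ 2)%N in small large *.
have M0 : (0 < M)%N by rewrite expn_gt0 J0.
have MR : 0 < M%:R :> R by rewrite ltr0n.
have split_le : freq (sample_size J) (fun n => z < n)%N <=
   \sum_(z.+1 <= m < M.+1) freq (sample_size J) (fun n => m %| n)%N
   + freq (sample_size J) (fun n => M < n)%N.
  rewrite /frequency -mulr_sumr -mulrDr ler_wpM2l ?invr_ge0 //.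
  rewrite exchange_big -big_split /=; apply: ler_sum => n _.
  have [lt_z|_] := ltnP z (gcd_along n); last by rewrite addr_ge0 // sumr_ge0.
  have [_|le_M] := ltnP M (gcd_along n); first by rewrite lerDr sumr_ge0.
  rewrite addr0 (bigD1_seq (gcd_along n)) ?iota_uniq ?mem_index_iota ?lt_z //=.
  by rewrite dvdnn lerDl sumr_ge0.
have sum_le : \sum_(z.+1 <= m < M.+1) freq (sample_size J) (fun n => m %| n)%N <=
   \sum_(z.+1 <= m < M.+1) ((m%:R ^+ 2)^-1 + (e / 3 / M%:R + (sample_size J)%:R^-1)).
  rewrite big_nat [leRHS]big_nat; apply: ler_sum => m /andP[lt_z le_M].
  have := small m; rewrite (leq_trans _ lt_z) //= -ltnS le_M => /(_ isT).
  by rewrite ler_norml; lra.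
have cst_le : \sum_(z.+1 <= m < M.+1) (e / 3 / M%:R + (sample_size J)%:R^-1) <= e / 3 + e / 3.
  rewrite sumr_const_nat; apply: (@le_trans _ _ ((e / 3 / M%:R + (sample_size J)%:R^-1) *+ M)).
    rewrite -!(mulr_natr (_ + _)) ler_wpM2l ?ler_nat; [by []| |lia].
    by rewrite addr_ge0 ?invr_ge0 // divr_ge0 ?(ltW e3).
  rewrite -(mulr_natr (_ + _)) mulrDl divfK ?gt_eqF // lerD2l; apply: le_trans Je.
  rewrite mulrC ler_pdivrMr // ler_pdivlMl ?ltr0n // -natrM ler_nat /M sample_sizeE.
  by rewrite -expnS leq_pexp2l.
apply: le_trans split_le _; rewrite big_split /= in sum_le.
have := @sum_inv_sqr_le R z M.+1 z0.
move: sum_le cst_le large.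
move: (\sum_(_ <= _ < _) freq _ _) (\sum_(_ <= _ < _) (_ + _)) (\sum_(_ <= _ < _) _^-1) (freq _ _) (z%:R^-1) => s1 s2 s3 s4 s5.
lra.
Qed.

Lemma cvg_frequency_gcd k : (0 < k)%N ->
  (fun N => freq N (pred1 k)) @ \oo --> 1 / (k%:R ^+ 2 * zeta (2 : R)).
Proof.
move=> k0; apply: cvg_frequency_sample_size.
apply: cvg_frequency_eq => //; first exact: gcd_along_gt0.
  exact: cvg_frequency_dvdn.
exact: frequency_tail.
Qed.

End TypicalPaths.

(** * Density of k-visible points *)

Theorem theorem2 (d : measure_display) (T : measurableType d) (R : realType)
    (P : probability T R) (Y : nat -> {RV P >-> (nat * nat)%type})
    (a0 b0 : nat) (ha0 : (0 < a0)%N) (hb0 : (0 < b0)%N)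
    (hY : polya_walk Y a0 b0) (k : nat) (hk : (0 < k)%N) :
  {ae P, forall w : T,
    (fun N : nat => N%:R^-1 * \sum_(1 <= n < N.+1) \1_(visible k) (Y n w) : R)
      @ \oo --> 1 / (k%:R ^+ 2 * zeta (2 : R))}.
Proof.
have typical : {ae P, forall w, forall i : nat, exists j0, forall J, (j0 <= J)%N ->
    ~~ atypical a0 b0 (i.+1%:R^-1 : R) J (mkseq (walk_path Y w) (sample_size J))}.
  by apply/ae_foralln => i; apply: ae_eventually_typical; rewrite ?invr_gt0.
apply: filterS2 typical (ae_follows_walk_path ha0 hb0 hY) => w typ fw.
have -> : (fun N : nat => N%:R^-1 * \sum_(1 <= n < N.+1) \1_(visible k) (Y n w) : R) =
    (fun N => frequency (gcd_along a0 b0 (walk_path Y w)) N (pred1 k)).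
  apply/funext => N; congr (_ * _); apply: eq_bigr => n _; rewrite indicE.
  have := fw n n; rewrite size_mkseq => /(_ (leqnn n)).
  rewrite -{2}(size_mkseq (walk_path Y w) n) take_size => ->.
  have g_eq : gcd_along a0 b0 (walk_path Y w) n =
      gcdn (urn a0 b0 (mkseq (walk_path Y w) n)).1 (urn a0 b0 (mkseq (walk_path Y w) n)).2.
    rewrite /gcd_along /urn /= -[RHS]gcdnDr addnC; congr gcdn.
    have {1}<- : (count id (mkseq (walk_path Y w) n) + count negb (mkseq (walk_path Y w) n) = n)%N.
      by rewrite -[RHS](size_mkseq (walk_path Y w)) -(count_predC id).
    by lia.
  rewrite (_ : (_ \in visible k) = (pred1 k (gcd_along a0 b0 (walk_path Y w) n))) //.
  by apply/idP/idP; rewrite inE /= g_eq => /eqP.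
exact: cvg_frequency_gcd.
Qed.
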